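(* Let $F(n)$ denote the number of unordered factorizations of a positive integer $n$ into pairwise coprime integers larger than one. Then, as $x \to \infty$, \[\sum_{n \leq x} F(n) = x\exp\left((c + o(1))\sqrt{\frac{\log x}{\log_2 x}}\right),\] where $c = 2\sqrt{2}\, e^{-\gamma/2}$ and $\gamma$ is the Euler–Mascheroni constant.
   Context: $\log_k x$ denotes the $k$-th iterate of the natural logarithm (so $\log_2 x = \log\log x$). Unordered factorizations are counted without regard to the order of the factors; the trivial factorization $n = n$ counts (and by convention $F(1)=1$, the empty factorization). *)

(* Defs.v *)
From mathcomp Require Import all_boot all_order all_algebra.
From mathcomp Require Import all_classical all_reals all_analysis.
Import Order.TTheory GRing.Theory Num.Theory numFieldNormedType.Exports.

Set Implicit Arguments.
Unset Strict Implicit.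
Unset Printing Implicit Defensive.

Local Open Scope ring_scope.

(* Pairwise coprime factors larger than one are distinct, so the multiset of
   factors of an unordered factorization is a plain finite set; every factor of
   n > 0 is at most n, hence lies in 'I_n.+1.  For n = 1 the only such set is
   the empty one (the empty factorization). *)
Definition coprime_factorization (n : nat) (A : {set 'I_n.+1}) : bool :=
  [&& [forall d in A, (1 < d)%N],
      [forall d in A, forall e in A, (d != e) ==> coprime d e]
    & (\prod_(d in A) (d : nat) == n)%N].

Definition nb_coprime_factorizations (n : nat) : nat :=
  #|[set A : {set 'I_n.+1} | coprime_factorization A]|.

(* [series harmonic n] is 1 + 1/2 + ... + 1/n. *)
Definition euler_gamma (R : realType) : R :=
  limn (fun n : nat => series (@harmonic R) n - ln n%:R).

(* Main.v *)
Require Import Defs.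
From mathcomp Require Import all_boot all_order all_algebra.
From mathcomp Require Import all_classical all_reals all_analysis.
From mathcomp Require Import ring lra zify.
Import Order.TTheory GRing.Theory Num.Theory numFieldNormedType.Exports.

(* F(n) is the Bell number of omega(n), and Dobinski-type counting gives
   m^omega(n) / m! <= F(n) <= sum_m m^omega(n) / m!, so the problem reduces to
   sum_(n <= x) m^omega(n).  Since (m+1)^omega(n) is the sum of m^omega(d) over the
   squarefree divisors d of n, this is x * sum_(d <= x) m^omega(d) / d up to
   constants.  The last sum is bounded above by Rankin's trick and below by
   exponential tilting, in terms of prod_p (1 + m p^(-1-s)) with s of order
   m / log x.  The primes below m^(1-eps) are negligible there, and for the others
   sum_(p > z) p^(-1-s) = - log s - log log z - gamma + o(1), which only needs
   Mertens' first theorem: partial summation over dyadic blocks compares the sum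
   with sum_(k > K) e^(-tk) / k, whose constant is Euler's gamma.  Hence
   sum_(n <= x) m^omega(n) / m! = x exp(m (2 + log (mu^2 / m^2) + o(1))) with
   mu^2 = 2 e^(-gamma) log x / log log x, and the maximum exp(2 mu) is at m = mu. *)

Set Implicit Arguments.
Unset Strict Implicit.
Unset Printing Implicit Defensive.

(** * Factorizations and labellings of the prime divisors *)

Section CoprimeFactorizations.
Local Open Scope nat_scope.

(** Put l = log log x, so x = exp (exp l) and mu is exp (l/2) up to a power of l. The factor 2 in
    mu^2 comes from the place where the small primes are cut off: if z = exp (k l) with k close to
    1/2, then log log z is log l - log 2 up to a small error. The two bounds need k on opposite
    sides of 1/2. From above, each prime p <= z costs up to log (m + 1), so z must be small against
    m. From below, the primes p <= z are dropped and replacing log (1 + m/p) by m/p costs m^2/p^2,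
    so z must be large against m. The prime sum gets multiplied by m, so a bounded error in it would
    change c. Mertens' first theorem has a bounded error, but partial summation against x^(-s) / log
    x divides it by log z. The upper bound adds up O(log x) values of m, a number too small to
    matter. The lower bound keeps a single m. There the tilt is (1 + h) m / log x instead of
    Rankin's m / log x: it concentrates log d near log x / (1 + h), strictly inside the window, and
    both tails become exponentially small in m. *)

Lemma card_ffun_same_kernel (T U V : finType) (h : T -> U) :
  (forall u, exists t, h t = u) ->
  #|[set f : {ffun T -> V} |
      [forall p, forall q, (f p == f q) == (h p == h q)]]| = #|V| ^_ #|U|.
Proof.
(* A function with the kernel of the surjection [h] is an injection [U -> V] composed with [h]; the
   section [s] recovers that injection. *)
move=> /fin_all_exists[s sK]; rewrite -card_inj_ffuns.
rewrite -(card_in_imset (f := fun g : {ffun U -> V} => [ffun t => g (h t)])).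
  apply: eq_card => f; rewrite inE; apply/idP/imsetP.
    move=> /forallP fP; exists [ffun u => f (s u)].
      rewrite inE; apply/injectiveP => u v; rewrite !ffunE => /eqP.
      by have /forallP/(_ (s v))/eqP -> := fP (s u); rewrite !sK => /eqP.
    apply/ffunP => t; rewrite !ffunE; apply/eqP.
    by have /forallP/(_ (s (h t)))/eqP -> := fP t; rewrite sK.
  move=> [g]; rewrite inE => /injectiveP gI ->.
  by apply/forallP => p; apply/forallP => q; rewrite !ffunE (inj_eq gI).
move=> g g' _ _ /ffunP gg'; apply/ffunP => u.
by have := gg' (s u); rewrite !ffunE sK.
Qed.

Lemma coprime_prodl (I : Type) (r : seq I) (P : pred I) (F : I -> nat) m :
  (forall i, P i -> coprime (F i) m) -> coprime (\prod_(i <- r | P i) F i) m.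
Proof.
move=> H; elim/big_rec: _ => [|i y Pi]; first by rewrite coprime1n.
by move=> ?; rewrite coprimeMl H.
Qed.

Lemma prime_dvd_prod (I : finType) (P : pred I) (F : I -> nat) p :
  prime p -> p %| \prod_(i | P i) F i -> exists2 i, P i & p %| F i.
Proof.
move=> pp pd; have [/existsP[i /andP[Pi pF]]|] := boolP [exists i, P i && (p %| F i)].
  by exists i.
rewrite negb_exists => /forallP H; suff : coprime (\prod_(i | P i) F i) p.
  by rewrite coprime_sym prime_coprime// pd.
apply: coprime_prodl => i Pi; rewrite coprime_sym prime_coprime//.
by have := H i; rewrite Pi.
Qed.

Section Factorization.
Variable n : nat.
Hypothesis n_gt0 : 0 < n.
Implicit Types (A B : {set 'I_n.+1}) (d e : 'I_n.+1).

Lemma factor_gt1 A d : coprime_factorization A -> d \in A -> 1 < d.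
Proof. by move=> /and3P[/forallP/(_ d)/implyP]. Qed.

Lemma factor_uniq A d e p : coprime_factorization A -> d \in A -> e \in A ->
  prime p -> p %| d -> p %| e -> d = e.
Proof.
move=> /and3P[_ /forallP/(_ d)/implyP H _] dA eA pp pd pe.
have /forallP/(_ e)/implyP/(_ eA)/implyP := H dA.
case: eqVneq => // _ /(_ isT) cde.
have : p %| gcdn d e by rewrite dvdn_gcd pd.
by rewrite (eqP cde) dvdn1; move: pp; case: eqP => // ->.
Qed.

Lemma prod_factors A : coprime_factorization A -> \prod_(d in A) (d : nat) = n.
Proof. by move=> /and3P[_ _ /eqP]. Qed.

Lemma factor_dvd A d : coprime_factorization A -> d \in A -> d %| n.
Proof. by move=> cA dA; rewrite -[X in _ %| X](prod_factors cA)// (bigD1 d)//= dvdn_mulr. Qed.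

(** The other factors are coprime to [d], so [d] carries the full power in [n] of each of its
    primes: a factor can be rebuilt from the set of its primes. *)
Lemma factor_partn A d : coprime_factorization A -> d \in A -> n`_\pi(d) = d.
Proof.
move=> cA dA; have d0 : 0 < d by rewrite ltnW// (factor_gt1 cA).
have P0 : 0 < \prod_(i in A | i != d) (i : nat).
  by apply: prodn_cond_gt0 => i /andP[iA _]; rewrite ltnW// (factor_gt1 cA).
have -> : n`_\pi(d) = (\prod_(e in A) (e : nat))`_\pi(d) by rewrite prod_factors.
rewrite (bigD1 d)//= partnM//.
rewrite [d`_ _]part_pnat_id ?pnat_pi// part_p'nat ?muln1//.
rewrite -coprime_pi'// coprime_sym; apply: coprime_prodl => i /andP[iA id].
have /and3P[_ /forallP/(_ i)/implyP/(_ iA)/forallP/(_ d)/implyP/(_ dA)] := cA.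
by rewrite id.
Qed.

Let k := size (primes n).
Let p_ (t : 'I_k) := nth 0 (primes n) t.

Let p_mem t : p_ t \in primes n.
Proof. exact: mem_nth. Qed.

Let p_prime t : prime (p_ t).
Proof. by have := p_mem t; rewrite mem_primes => /andP[]. Qed.

Let p_surj q : q \in primes n -> exists t, p_ t = q.
Proof.
move=> qn; have H : index q (primes n) < k by rewrite index_mem.
by exists (Ordinal H); rewrite /p_ nth_index.
Qed.

Let p_inj : injective p_.
Proof. by move=> s t /eqP; rewrite nth_uniq ?primes_uniq// => /eqP/val_inj. Qed.

Let same_factor A (s t : 'I_k) := [exists d in A, (p_ s %| d) && (p_ t %| d)].

Let compatible j A (f : {ffun 'I_k -> 'I_j}) :=
  [forall s, forall t, (f s == f t) == same_factor A s t].

Let ex_factor A t : coprime_factorization A -> exists2 d, d \in A & p_ t %| d.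
Proof.
move=> cA; apply: prime_dvd_prod => //.
by rewrite prod_factors//; have := p_mem t; rewrite mem_primes => /and3P[].
Qed.

(** Every prime of [n] lies in exactly one factor and every factor contains a prime (its [pdiv]), so
    primes map onto factors. Compatible labellings are then the injective labellings of the
    factors. *)
Let card_compatible j A : coprime_factorization A ->
  #|[set f : {ffun 'I_k -> 'I_j} | compatible A f]| = j ^_ #|A|.
Proof.
move=> cA.
have /fin_all_exists[h hP] t : exists d : {d | d \in A}, p_ t %| val d.
  by have [d dA pd] := ex_factor t cA; exists (exist _ d dA).
have -> : #|A| = #|{: {d | d \in A}}| by rewrite card_sig.
rewrite -[j in RHS]card_ord -(card_ffun_same_kernel _ (h := h)).
  apply: eq_card => f; rewrite !inE; apply: eq_forallb => s.
  apply: eq_forallb => t; congr (_ == _); apply/existsP/eqP.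
    move=> [d /and3P[dA sd td]]; apply: val_inj.
    rewrite -(factor_uniq cA dA (valP (h s)) (p_prime s))//.
    by rewrite -(factor_uniq cA dA (valP (h t)) (p_prime t)).
  by move=> hst; exists (val (h s)); rewrite (valP (h s)) hP/= hst hP.
move=> [d dA]; have d1 := factor_gt1 cA dA.
have [|t tE] := @p_surj (pdiv d).
  by rewrite mem_primes pdiv_prime// n_gt0 (dvdn_trans (pdiv_dvd _))// (factor_dvd cA).
exists t; apply: val_inj; rewrite /=.
apply: (factor_uniq cA (valP _) dA (p_prime t)) => //.
by rewrite tE pdiv_dvd.
Qed.

(** In any factorization compatible with [f], the factor containing [p_ t] has as primes exactly
    those labelled [f t]; this description does not depend on the factorization, and [factor_partn]
    turns it into equality of the factors. *)
Let compatible_sub j A B (f : {ffun 'I_k -> 'I_j}) :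
  coprime_factorization A -> coprime_factorization B ->
  compatible A f -> compatible B f -> A \subset B.
Proof.
move=> cA cB fA fB; apply/fintype.subsetP => d dA; have d1 := factor_gt1 cA dA.
have [|t tE] := @p_surj (pdiv d).
  by rewrite mem_primes pdiv_prime// n_gt0 (dvdn_trans (pdiv_dvd _))// (factor_dvd cA).
have td : p_ t %| d by rewrite tE pdiv_dvd.
have [e eB te] := ex_factor t cB.
suff -> : d = e by [].
apply: val_inj; rewrite /= -(factor_partn cA dA) -(factor_partn cB eB).
have sub C c : coprime_factorization C -> c \in C -> p_ t %| c -> compatible C f ->
    forall q, (q \in \pi(c)) = [exists s, (p_ s == q) && (f s == f t)].
  move=> cC cc tc fC q; apply/idP/existsP.
    rewrite mem_primes => /and3P[qp _ qc].
    have [|s sE] := @p_surj q.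
      by rewrite mem_primes qp n_gt0 (dvdn_trans qc)// (factor_dvd cC).
    exists s; rewrite sE eqxx/=.
    have /forallP/(_ s)/forallP/(_ t)/eqP -> := fC.
    by apply/existsP; exists c; rewrite cc sE qc tc.
  move=> [s /andP[/eqP <-]].
  have /forallP/(_ s)/forallP/(_ t)/eqP -> := fC.
  move=> /existsP[c' /and3P[c'C sc' tc']].
  rewrite (factor_uniq cC cc c'C (p_prime t))//.
  by rewrite mem_primes p_prime sc' ltnW// (factor_gt1 cC c'C).
by apply: eq_partn => q; rewrite (sub A d)// (sub B e).
Qed.

Let ex_compatible j (f : {ffun 'I_k -> 'I_j}) :
  exists2 A, coprime_factorization A & compatible A f.
Proof.
pose D i := \prod_(t | f t == i) p_ t ^ logn (p_ t) n.
have nE : \prod_t p_ t ^ logn (p_ t) n = n.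
  rewrite [in RHS](prod_prime_decomp n_gt0) prime_decompE big_map/=.
  by rewrite (big_nth 0) big_mkord.
have D0 i : 0 < D i.
  by apply: prodn_cond_gt0 => t _; rewrite expn_gt0 prime_gt0.
have pD t i : (p_ t %| D i) = (f t == i).
  apply/idP/idP.
    move=> /(prime_dvd_prod (p_prime t))[s /eqP <-].
    by rewrite Euclid_dvdX// => /andP[]; rewrite dvdn_prime2// => /eqP/p_inj ->.
  move=> fi; rewrite /D (bigD1 t)//= dvdn_mulr// dvdn_exp//.
  by rewrite logn_gt0 p_mem.
have Dn i : D i < n.+1.
  rewrite ltnS dvdn_leq// -[X in _ %| X]nE (bigID (fun t => f t == i))/=.
  exact: dvdn_mulr.
have Dv i : (inord (D i) : 'I_n.+1) = D i :> nat by rewrite inordK.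
have cD i i' : i != i' -> coprime (D i) (D i').
  move=> ii'; apply: coprime_prodl => s /eqP si.
  apply: coprimeXl; rewrite prime_coprime ?p_prime// pD si.
  exact: ii'.
(* A label outside [codom f] gives the empty product 1, which is not a legal factor. *)
exists [set inord (D i) | i in codom f].
  apply/and3P; split.
  - apply/forallP => d; apply/implyP => /imsetP[_ /codomP[t ->] ->].
    by rewrite Dv (leq_trans (prime_gt1 (p_prime t)))// dvdn_leq// pD.
  - apply/forallP => d; apply/implyP => /imsetP[i _ ->].
    apply/forallP => e; apply/implyP => /imsetP[i' _ ->].
    apply/implyP => H; rewrite !Dv cD//.
    by apply: contraNneq H => ->.
  rewrite big_imset/=.
    under eq_bigr do rewrite Dv.
    rewrite -[X in _ == X]nE (partition_big f [in codom f])//= => t _.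
    exact: codom_f.
  move=> i i' /codomP[t ->] /codomP[t' ->] /(congr1 val)/=; rewrite !Dv => H.
  by apply/eqP; rewrite -pD -H pD.
apply/forallP => s; apply/forallP => t; apply/eqP; apply/eqP/existsP.
  move=> st; exists (inord (D (f s))); apply/andP; split.
    by apply/imsetP; exists (f s) => //; exact: codom_f.
  by rewrite Dv !pD st eqxx.
by move=> [_ /andP[/imsetP[i _ ->]]]; rewrite Dv !pD => /andP[/eqP -> /eqP].
Qed.

(* Each [f : 'I_k -> 'I_j] is an injective labelling of the factors of exactly
   one factorization of [n], namely the one grouping primes of equal label. *)
Lemma sum_ffact_factorizations j :
  \sum_(A : {set 'I_n.+1} | coprime_factorization A) j ^_ #|A| = j ^ size (primes n).
Proof.
transitivity (\sum_(A : {set 'I_n.+1} | coprime_factorization A)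
               \sum_(f : {ffun 'I_k -> 'I_j}) (compatible A f : nat)).
  apply: eq_bigr => A cA; rewrite -card_compatible// -sum1_card big_mkcond/=.
  by apply: eq_bigr => f _; rewrite inE; case: compatible.
rewrite exchange_big/= -[in RHS](card_ord j) -[X in _ ^ X]card_ord -card_ffun -sum1_card.
apply: eq_bigr => f _; have [A cA fA] := ex_compatible f.
rewrite (bigD1 A)//= fA big1// => B /andP[cB BA].
apply/eqP; rewrite eqb0; apply: contraNN BA => fB.
by rewrite finset.eqEsubset !(compatible_sub (f := f)).
Qed.

Lemma card_factorization_le A : coprime_factorization A -> 2 ^ #|A| <= n.
Proof.
move=> cA; rewrite -[X in _ <= X](prod_factors cA) -prod_nat_const.
by apply: leq_prod => d dA; exact: factor_gt1 cA dA.
Qed.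

(** Every falling factorial [j ^_ #|A|] is at most [j!], and it vanishes when [A] has more than [j]
    elements. *)
Lemma expn_le_nb_factorizations j :
  j ^ size (primes n) <= j`! * nb_coprime_factorizations n.
Proof.
rewrite -sum_ffact_factorizations mulnC /nb_coprime_factorizations -sum_nat_const.
rewrite big_set/=; apply: leq_sum => A _.
have [Aj|jA] := leqP #|A| j; last by rewrite ffact_small.
by rewrite -(ffact_fact Aj) leq_pmulr ?fact_gt0.
Qed.

(** Only the sets of exactly [j] factors are kept, for which the falling factorial is [j!]. *)
Lemma card_factorizations_size_le j :
  #|[set A : {set 'I_n.+1} | coprime_factorization A && (#|A| == j)]| * j`!
    <= j ^ size (primes n).
Proof.
rewrite -sum_ffact_factorizations -sum_nat_const.
rewrite [X in _ <= X](bigID (fun A => #|A| == j))/= (leq_trans _ (leq_addr _ _))//.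
rewrite big_set/= leq_sum// => A /andP[_ /eqP ->].
by rewrite ffactnn.
Qed.

Lemma nb_factorizations_split m : n < 2 ^ m -> nb_coprime_factorizations n =
  \sum_(j < m) #|[set A : {set 'I_n.+1} | coprime_factorization A && (#|A| == j)]|.
Proof.
move=> nm; rewrite /nb_coprime_factorizations -sum1_card big_set/=.
have lt_m A : coprime_factorization A -> #|A| < m.
  move=> cA; rewrite -(ltn_exp2l _ _ (isT : 1 < 2)).
  by rewrite (leq_ltn_trans _ nm)// card_factorization_le.
case: m nm lt_m => [|m] nm lt_m; first by move: nm; rewrite ltnNge n_gt0.
rewrite (partition_big (fun A : {set 'I_n.+1} => inord #|A| : 'I_m.+1) predT)//=.
apply: eq_bigr => j _; rewrite -sum1_card big_set/=; apply: eq_bigl => A.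
transitivity (coprime_factorization A && (#|A| == j)); last by [].
rewrite -[LHS]/(coprime_factorization A && _).
case cA: (coprime_factorization A) => //=.
by rewrite -val_eqE /= (inordK (lt_m _ cA)).
Qed.

End Factorization.

End CoprimeFactorizations.

Local Open Scope ring_scope.

(** * Sums over sets of primes *)

Lemma prod1D_subset (R : comNzRingType) (I : finType) (B : {set I}) (F : I -> R) :
  \prod_(i in B) (1 + F i) = \sum_(A : {set I} | A \subset B) \prod_(i in A) F i.
Proof.
rewrite big_mkcond/=.
rewrite (eq_bigr (fun i => (if i \in B then F i else 0) + 1)); last first.
  by move=> i _; case: ifP => _; rewrite ?add0r// addrC.
rewrite bigA_distr [RHS]big_mkcond/=; apply: eq_bigr => A _.
case: ifPn => [/fintype.subsetP AB|/subsetPn[i iA iB]].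
  rewrite [RHS]big_mkcond/=; apply: eq_bigr => i _.
  by case: ifP => // /AB ->.
by rewrite (bigD1 i)//= iA (negbTE iB) mul0r.
Qed.

Definition prime_set M : {set 'I_M} := [set p : 'I_M | prime p].

(** Sets of primes stand for squarefree integers from here on: [A] represents the divisor given by
    its product. *)
Lemma primes_subset_dvd M n (A : {set 'I_M}) : (0 < n)%N ->
  (A \subset [set p : 'I_M | (p : nat) \in primes n]) =
  (A \subset prime_set M) && (\prod_(p in A) (p : nat) %| n)%N.
Proof.
move=> n0; apply/fintype.subsetP/andP.
  move=> H; split; first by apply/fintype.subsetP => p /H; rewrite !inE mem_primes => /andP[].
  rewrite -big_enum/=.
  have : {subset enum A <= [set p : 'I_M | (p : nat) \in primes n]}.
    by move=> p; rewrite mem_enum => /H.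
  elim: (enum A) (enum_uniq A) => [|p s IH]/=; first by rewrite big_nil dvd1n.
  move=> /andP[ps us] sP; rewrite big_cons Gauss_dvd.
    rewrite IH//; last by move=> q qs; apply: sP; rewrite inE qs orbT.
    by have := sP p; rewrite !inE eqxx mem_primes => /(_ isT)/and3P[_ _ ->].
  rewrite coprime_sym big_seq; apply: coprime_prodl => q qs.
  have := sP q; have := sP p; rewrite !inE qs eqxx orbT !mem_primes.
  move=> /(_ isT)/and3P[pp _ _] /(_ isT)/and3P[qp _ _].
  rewrite prime_coprime// dvdn_prime2//; apply: contraNneq ps => qp'.
  by rewrite -(val_inj qp').
move=> [/fintype.subsetP H dn] p pA; rewrite inE mem_primes n0/=.
have := H p pA; rewrite inE => ->/=.
by rewrite (dvdn_trans _ dn)// (bigD1 p)//= dvdn_mulr.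
Qed.

Lemma card_prime_divisors M n : (0 < n < M)%N ->
  #|[set p : 'I_M | (p : nat) \in primes n]| = size (primes n).
Proof.
move=> /andP[n0 nM]; rewrite cardE -(size_map val); apply: perm_size.
apply: uniq_perm; rewrite ?primes_uniq ?(map_inj_uniq val_inj) ?enum_uniq// => p.
apply/mapP/idP => [[q + ->]|pn]; first by rewrite mem_enum inE.
have pM : (p < M)%N.
  by rewrite (leq_ltn_trans _ nM)// dvdn_leq//; move: pn; rewrite mem_primes => /and3P[].
by exists (Ordinal pM); rewrite ?mem_enum ?inE.
Qed.

Section PrimeSets.
Context {R : realType}.

Lemma expR_ge1 (x : R) : (1 <= expR x) = (0 <= x).
Proof. by rewrite -[X in X <= _]expR0 ler_expR. Qed.

Lemma sum_expn_omega M X j : (X < M)%N ->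
  \sum_(1 <= n < X.+1) (j.+1%:R : R) ^+ size (primes n) =
  \sum_(A : {set 'I_M} | A \subset prime_set M)
    j%:R ^+ #|A| * (X %/ \prod_(p in A) (p : nat))%:R.
Proof.
move=> XM.
transitivity (\sum_(1 <= n < X.+1) \sum_(A : {set 'I_M} | A \subset prime_set M)
    (j%:R : R) ^+ #|A| * (\prod_(p in A) (p : nat) %| n)%:R).
  apply: eq_big_nat => n /andP[n0 nX].
  rewrite -(@card_prime_divisors M) ?n0 ?(leq_trans nX)//.
  rewrite -prodr_const (eq_bigr (fun=> 1 + j%:R)); last first.
    by move=> _ _; rewrite -natr1 addrC.
  rewrite prod1D_subset [RHS](bigID (fun A : {set 'I_M} => (\prod_(p in A) (p : nat) %| n)%N))/=.
  rewrite [X in _ = _ + X]big1 ?addr0; last by move=> A /andP[_ /negbTE ->]; rewrite mulr0.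
  apply: eq_big => [A|A]; first by rewrite primes_subset_dvd.
  by rewrite primes_subset_dvd// => /andP[_ ->]; rewrite mulr1 prodr_const.
rewrite exchange_big/=; apply: eq_bigr => A _.
by rewrite -mulr_sumr divn_count_dvd natr_sum.
Qed.

Definition log_prod M (A : {set 'I_M}) : R := \sum_(p in A) ln (p : nat)%:R.

Lemma expR_log_prod M (A : {set 'I_M}) : A \subset prime_set M ->
  expR (log_prod A) = (\prod_(p in A) (p : nat))%:R.
Proof.
move=> /fintype.subsetP AP; rewrite expR_sum natr_prod; apply: eq_bigr => p /AP.
by rewrite inE => pp; rewrite lnK// posrE ltr0n prime_gt0.
Qed.

Definition weight (j : nat) M (A : {set 'I_M}) : R := \prod_(p in A) (j%:R / (p : nat)%:R).

(** The Dirichlet series of j^omega(d) at 1 + s, restricted to squarefree d with all primes below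
    [M]; the shift by 1 puts the relevant range at small positive [s]. *)
Definition euler_prod (j M : nat) (s : R) : R :=
  \prod_(p < M | prime p) (1 + j%:R / p%:R * expR (- s * ln p%:R)).

Lemma weight_ge0 j M (A : {set 'I_M}) : 0 <= weight j A.
Proof. by apply: prodr_ge0 => p _; rewrite divr_ge0. Qed.

Lemma weightE j M (A : {set 'I_M}) :
  weight j A = j%:R ^+ #|A| / (\prod_(p in A) (p : nat))%:R.
Proof. by rewrite /weight big_split/= prodr_const natr_prod prodfV. Qed.

Lemma euler_prodE j M s : euler_prod j M s =
  \sum_(A : {set 'I_M} | A \subset prime_set M) weight j A * expR (- s * log_prod A).
Proof.
rewrite /euler_prod -big_set prod1D_subset; apply: eq_bigr => A _.
by rewrite big_split/= -expR_sum mulr_sumr.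
Qed.

Lemma log_prod_le M (A : {set 'I_M}) X : A \subset prime_set M -> (0 < X)%N ->
  (log_prod A <= ln X%:R) = (\prod_(p in A) (p : nat) <= X)%N.
Proof.
move=> AP X0; rewrite -ler_expR lnK ?posrE ?ltr0n// expR_log_prod//.
by rewrite ler_nat.
Qed.

(** Rankin's trick: a divisor d <= X is charged the factor (X/d)^s >= 1, while d > X contributes
    nothing because [X %/ d] is 0. *)
Lemma sum_expn_omega_le j M X s : (0 < X < M)%N -> 0 <= s ->
  \sum_(1 <= n < X.+1) (j.+1%:R : R) ^+ size (primes n) <=
    X%:R * expR (s * ln X%:R) * euler_prod j M s.
Proof.
move=> /andP[X0 XM] s0; rewrite (sum_expn_omega _ XM) euler_prodE mulr_sumr.
apply: ler_sum => A AP; set d := (\prod_(p in A) _)%N.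
have [Xd|dX] := ltnP X d.
  rewrite divn_small// mulr0 !mulr_ge0 ?expR_ge0 ?weight_ge0//.
have d0 : (0 < d)%N.
  by move/fintype.subsetP : AP => AP; apply: prodn_cond_gt0 => p /AP; rewrite inE => /prime_gt0.
have -> : X%:R * expR (s * ln X%:R) * (weight j A * expR (- s * log_prod A)) =
  X%:R * weight j A * expR (s * (ln X%:R - log_prod A)).
  rewrite mulrBr expRD mulNr; ring.
apply: (@le_trans _ _ (X%:R * weight j A)).
  rewrite weightE mulrCA ler_wpM2l ?exprn_ge0// ler_pdivlMr ?ltr0n//.
  by rewrite -natrM ler_nat leq_trunc_div.
rewrite ler_peMr ?mulr_ge0 ?weight_ge0//.
by rewrite expR_ge1 mulr_ge0// subr_ge0 log_prod_le.
Qed.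

(** For d <= X the floor of X/d is at least 1, hence at least X/(2d). Only [X < M] is asked, so [M]
    may later be taken as large as the Euler product needs. *)
Lemma sum_expn_omega_ge j M X : (0 < X < M)%N ->
  X%:R / 2 * \sum_(A : {set 'I_M} | (A \subset prime_set M) && (log_prod A <= ln X%:R))
     weight j A <= \sum_(1 <= n < X.+1) (j.+1%:R : R) ^+ size (primes n).
Proof.
move=> /andP[X0 XM]; rewrite (sum_expn_omega _ XM) mulr_sumr.
rewrite [leRHS](bigID (fun A : {set 'I_M} => log_prod A <= ln X%:R))/=.
rewrite -[leLHS]addr0 lerD//; last first.
  by apply: sumr_ge0 => A _; rewrite mulr_ge0// exprn_ge0.
apply: ler_sum => A /andP[AP]; rewrite log_prod_le//; set d := (\prod_(p in A) _)%N => dX.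
have d0 : (0 < d)%N.
  by move/fintype.subsetP : AP => AP; apply: prodn_cond_gt0 => p /AP; rewrite inE => /prime_gt0.
rewrite weightE mulrCA ler_wpM2l ?exprn_ge0// ler_pdivrMr ?ltr0n//.
rewrite ler_pdivrMr// -!natrM ler_nat.
have := divn_eq X d; have := ltn_pmod X d0; have : (0 < X %/ d)%N by rewrite divn_gt0.
nia.
Qed.

(* Exponential tilting: restricting the tilted sum to the window ]b, a] costs at
   most the two Chernoff tails, which are again values of the same generating
   function. *)
Lemma tilted_window_le (I : finType) (P : pred I) (w v : I -> R) (s t a b : R) :
  0 <= s -> 0 <= t -> (forall i, P i -> 0 <= w i) ->
  expR (s * b) * (\sum_(i | P i) w i * expR (- s * v i)
    - expR (- t * a) * \sum_(i | P i) w i * expR (- (s - t) * v i)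
    - expR (t * b) * \sum_(i | P i) w i * expR (- (s + t) * v i))
  <= \sum_(i | P i && (v i <= a)) w i.
Proof.
move=> s0 t0 w0; rewrite !mulr_sumr -!sumrB mulr_sumr.
rewrite (bigID (fun i => v i <= a))/= -[leRHS]addr0.
(* The last factor is at most 1 everywhere and nonpositive outside the window; inside,
   [expR (s * (b - v i))] is at most 1 as well. *)
have E i : expR (s * b) * (w i * expR (- s * v i) -
   expR (- t * a) * (w i * expR (- (s - t) * v i)) -
   expR (t * b) * (w i * expR (- (s + t) * v i))) =
   w i * expR (s * (b - v i)) * (1 - expR (t * (v i - a)) - expR (t * (b - v i))).
  have -> : s * (b - v i) = s * b + - s * v i by ring.
  have -> : t * (v i - a) = t * v i + - t * a by ring.
  have -> : t * (b - v i) = t * b + - t * v i by ring.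
  have -> : - (s - t) * v i = - s * v i + t * v i by ring.
  have -> : - (s + t) * v i = - s * v i + - t * v i by ring.
  rewrite !expRD; ring.
apply: lerD.
  apply: ler_sum => i /andP[Pi va]; rewrite E.
  have [vb|bv] := leP (v i) b.
    apply: (@le_trans _ _ 0); last exact: w0.
    rewrite mulr_ge0_le0 ?mulr_ge0 ?expR_ge0 ?w0//.
    have : 1 <= expR (t * (b - v i)) by rewrite expR_ge1 mulr_ge0// subr_ge0.
    have := expR_ge0 (t * (v i - a)); lra.
  rewrite -mulrA ler_piMr ?w0//; apply: (@le_trans _ _ (expR (s * (b - v i)))).
    apply: ler_piMr; first exact: expR_ge0.
    have := expR_ge0 (t * (v i - a)); have := expR_ge0 (t * (b - v i)); lra.
  by rewrite expR_le1 mulr_ge0_le0// subr_le0 ltW.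
apply: sumr_le0 => i /andP[Pi]; rewrite -ltNge => av; rewrite E.
rewrite mulr_ge0_le0 ?mulr_ge0 ?expR_ge0 ?w0//.
have : 1 <= expR (t * (v i - a)) by rewrite expR_ge1 mulr_ge0// subr_ge0 ltW.
have := expR_ge0 (t * (b - v i)); lra.
Qed.

End PrimeSets.

(** * Mertens' first theorem along powers of two *)

Section Mertens.
Context {R : realType}.

Lemma ln_le_sub1 (x : R) : 0 < x -> ln x <= x - 1.
Proof. by move=> x0; have := @le_ln1Dx R (x - 1); rewrite subrKC; apply; lra. Qed.

Lemma ln_ge_1subV (x : R) : 0 < x -> 1 - x^-1 <= ln x.
Proof.
move=> x0; have := @ln_le_sub1 x^-1; rewrite invr_gt0 => /(_ x0).
by rewrite lnV ?posrE//; lra.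
Qed.

Lemma ln_nat_ge0 n : 0 <= ln (n%:R : R).
Proof. by case: n => [|n]; [rewrite ln0|rewrite ln_ge0// ler1n]. Qed.

Lemma ln2_ge_half : 2^-1 <= ln (2 : R).
Proof. by have := @ln_ge_1subV 2; lra. Qed.

Lemma ln2_le1 : ln (2 : R) <= 1.
Proof. by have := @ln_le_sub1 2; lra. Qed.

Lemma ln_natS_le n : (0 < n)%N -> ln (n.+1%:R : R) <= ln (n%:R) + n%:R^-1.
Proof.
move=> n0; have n0' : 0 < n%:R :> R by rewrite ltr0n.
rewrite -lerBlDl -ln_div ?posrE ?ltr0n//.
apply: le_trans (ln_le_sub1 _) _; first by rewrite divr_gt0// ltr0n.
by rewrite -natr1 mulrDl divff ?gt_eqF// mul1r addrAC subrr add0r.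
Qed.

Lemma ln_natS_ge n : (0 < n)%N -> ln (n%:R : R) + n.+1%:R^-1 <= ln n.+1%:R.
Proof.
move=> n0; have n0' : 0 < n%:R :> R by rewrite ltr0n.
rewrite -lerBrDl -ln_div ?posrE ?ltr0n//.
apply: le_trans (ln_ge_1subV _); last by rewrite divr_gt0// ltr0n.
rewrite invf_div -[X in X - _](@divff _ n.+1%:R) ?pnatr_eq0// -mulrBl -natr1.
by rewrite addrAC subrr add0r mul1r.
Qed.

Lemma ln_factS n : ln (n.+1`!%:R : R) = ln n.+1%:R + ln n`!%:R.
Proof. by rewrite factS natrM lnM// posrE ltr0n// fact_gt0. Qed.

(** * Stirling bounds and the prime factorization of factorials *)

Lemma ln_fact_ge n : n%:R * ln n%:R - n%:R <= ln (n`!%:R : R).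
Proof.
elim: n => [|n IH]; first by rewrite mul0r subr0 fact0 ln1.
rewrite ln_factS; case: n IH => [|n] IH; first by rewrite !ln1; lra.
have := @ln_natS_le n.+1 isT; set a := ln _ in IH *; set b := ln n.+2%:R => H.
rewrite -(natr1 n.+1); set m : R := n.+1%:R in IH H *.
have m0 : 0 < m by rewrite ltr0n.
have : m * b <= m * a + 1.
  by rewrite -[X in _ + X](@divff _ m) ?gt_eqF// -mulrDr ler_pM2l.
lra.
Qed.

Lemma ln_fact_le n : ln (n`!%:R : R) <= n%:R * ln n%:R.
Proof.
elim: n => [|n IH]; first by rewrite fact0 ln1 mul0r.
rewrite ln_factS; set y := ln n.+1%:R; rewrite -natr1 mulrDl mul1r.
rewrite [leRHS]addrC lerD2l (le_trans IH)// {}/y.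
case: n IH => [|n] _; first by rewrite !mul0r.
by rewrite ler_wpM2l// ler_ln ?posrE ?ltr0n// ler_nat.
Qed.

(** The term -n matters: at the saddle point it supplies one of the two copies of mu in the exponent
    of the lower bound. *)
Lemma ln_fact_le_sharp n : (0 < n)%N ->
  ln (n`!%:R : R) <= n%:R * ln n%:R - n%:R + ln n%:R + 1.
Proof.
elim: n => [//|n IH _]; case: n IH => [|n] IH; first by rewrite !ln1; lra.
rewrite ln_factS; have {IH} := IH isT.
have := @ln_natS_ge n.+1 isT; set a := ln n.+1%:R; set b := ln n.+2%:R => H IH.
rewrite -(natr1 n.+1) in H *; set m : R := n.+1%:R in IH H *.
have m0 : 0 < m by rewrite ltr0n.
have : (m + 1) * a + 1 <= (m + 1) * b.
  rewrite -[X in _ + X](@divff _ (m + 1)) ?gt_eqF ?addr_gt0//.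
  by rewrite -mulrDr ler_pM2l ?addr_gt0.
lra.
Qed.

Lemma ln_nat_primes M n : (0 < n <= M)%N ->
  ln (n%:R : R) = \sum_(0 <= p < M.+1 | prime p) (logn p n)%:R * ln p%:R.
Proof.
move=> /andP[n0 nM].
rewrite -[in LHS](partnT n0) (widen_partn _ nM) natr_prod.
rewrite (eq_bigl xpredT)// [RHS]big_mkcond/=.
elim: (index_iota 0 M.+1) => [|p s IH]; first by rewrite !big_nil ln1.
rewrite !big_cons -IH.
have [pp|/negbTE pp] := boolP (prime p); last by rewrite lognE pp expn0 mul1r add0r.
rewrite lnM ?posrE ?ltr0n ?expn_gt0 ?prime_gt0//; last first.
  rewrite -natr_prod ltr0n; apply: prodn_gt0 => q; rewrite expn_gt0.
  by have [->|] := posnP q; rewrite ?logn0 ?eqxx ?orbT// => ->.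
by rewrite natrX lnXn ?ltr0n ?prime_gt0// mulr_natl.
Qed.

Lemma ln_fact_primes n : ln (n`!%:R : R) =
  \sum_(0 <= p < n.+1 | prime p) (logn p n`!)%:R * ln p%:R.
Proof.
suff : forall m, (m <= n)%N -> ln (m`!%:R : R) =
  \sum_(0 <= p < n.+1 | prime p) (logn p m`!)%:R * ln p%:R by apply.
elim=> [_|m IH mn]; first by rewrite ln1 big1// => p _; rewrite logn1 mul0r.
rewrite ln_factS (@ln_nat_primes n)// IH ?(ltnW mn)// -big_split/=.
by apply: eq_bigr => p _; rewrite factS lognM ?fact_gt0// natrD mulrDl.
Qed.

Lemma logn_fact_ge p n : prime p -> n%:R / p%:R - 1 <= (logn p n`!)%:R :> R.
Proof.
move=> pp; have p0 := prime_gt0 pp.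
apply: (@le_trans _ _ (n %/ p)%:R).
  rewrite lerBlDr ler_pdivrMr ?ltr0n// natr1 -natrM ler_nat.
  by rewrite [leqLHS](divn_eq n p) mulSn addnC leq_add2r ltnW// ltn_pmod.
rewrite ler_nat logn_fact//; case: n => [|n]; first by rewrite div0n.
by rewrite big_ltn// expn1 leq_addr.
Qed.

Lemma logn_fact_le p n : prime p -> (logn p n`!)%:R <= n%:R / (p%:R - 1) :> R.
Proof.
move=> pp; have p1 : 1 < p%:R :> R by rewrite ltr1n prime_gt1.
have p0 : 0 < p%:R :> R by lra.
rewrite logn_fact// natr_sum.
(* Legendre's sum without the floors is a geometric series; its closed form makes the induction go
   through. *)
have : forall m, \sum_(1 <= k < m.+1) (n %/ p ^ k)%:R <=
    n%:R * ((1 - (p%:R ^+ m)^-1) / (p%:R - 1)) :> R.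
  elim=> [|m IH]; first by rewrite big_geq// expr0 invr1 subrr mul0r mulr0.
  rewrite big_nat_recr//=; apply: le_trans (lerD IH _) _.
    instantiate (1 := n%:R / p%:R ^+ m.+1).
    by rewrite ler_pdivlMr ?exprn_gt0// -natrX -natrM ler_nat leq_trunc_div.
  rewrite -mulrDr ler_wpM2l// exprS; set q := p%:R ^+ m.
  have q0 : 0 < q by rewrite exprn_gt0.
  rewrite le_eqVlt; apply/orP; left; apply/eqP; field.
  by apply/and3P; split; rewrite gt_eqF//; lra.
move=> /(_ n)/le_trans; apply; rewrite ler_wpM2l// ler_pdivrMr; last lra.
rewrite mulVf; last by rewrite gt_eqF//; lra.
by rewrite gerBl invr_ge0 exprn_ge0// ltW.
Qed.

(** Telescoping against u(x) = (log x + 3)/x, whose derivative is -(log x + 2)/x^2; the bound 3 is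
    u(1). *)
Lemma sum_ln_div_sqr n :
  \sum_(0 <= p < n.+1 | prime p) ln (p%:R : R) / (p%:R * (p%:R - 1)) <= 3.
Proof.
have F p : prime p -> ln (p%:R : R) / (p%:R * (p%:R - 1)) <=
    (ln p.-1%:R + 3) / p.-1%:R - (ln p%:R + 3) / p%:R.
  case: p => [//|p] /prime_gt1; rewrite ltnS => p0 /=.
  have := @ln_natS_le p p0; rewrite -natr1; set m : R := p%:R; set a := ln m.
  set b := ln (m + 1) => H; rewrite addrK.
  have m1 : 1 <= m by rewrite ler1n.
  have m0 : 0 < m by lra.
  have E : (a + 3) / m - (b + 3) / (m + 1) - b / ((m + 1) * m) =
     ((m + 1) * (a - b) + 3) / ((m + 1) * m).
    by field; apply/andP; split; rewrite gt_eqF//; lra.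
  rewrite -subr_ge0 E divr_ge0 ?mulr_ge0//; try lra.
  have : m * b <= m * a + 1.
    by rewrite -[X in _ + X](@divff _ m) ?gt_eqF// -mulrDr ler_pM2l.
  have : m^-1 <= 1 by rewrite invf_le1.
  lra.
case: n => [|n]; first by rewrite big_mkcond/= big_nat1.
rewrite big_ltn_cond//= big_ltn_cond//=.
apply: le_trans (ler_sum _ F) _.
rewrite big_mkcond/=.
apply: (@le_trans _ _ (\sum_(2 <= p < n.+2) ((ln (p.-1%:R : R) + 3) / p.-1%:R - (ln p%:R + 3) / p%:R))).
  apply: ler_sum_nat => p /andP[p2 _]; case: ifPn => // _.
  case: p p2 => [//|p]; rewrite ltnS => p0 /=.
  rewrite subr_ge0 ler_pdivrMr ?ltr0n//.
  have := @ln_natS_le p p0; rewrite -natr1; set m : R := p%:R; set a := ln m.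
  set b := ln (m + 1) => H.
  have m1 : 1 <= m by rewrite ler1n.
  have m0 : 0 < m by lra.
  have a0 : 0 <= a by exact: ln_nat_ge0.
  have -> : (a + 3) / m * (m + 1) = a + 3 + (a + 3) / m by field; rewrite gt_eqF.
  have : m^-1 <= (a + 3) / m by rewrite ler_pdivlMr// mulVf ?gt_eqF//; lra.
  lra.
pose u p := (ln (p%:R : R) + 3) / p%:R.
rewrite big_add1/= (eq_bigr (fun p => - (u p.+1 - u p))); last first.
  by move=> p _; rewrite opprB.
rewrite sumrN telescope_sumr//; have -> : u 1%N = 3 by rewrite /u ln1 add0r divr1.
have : 0 <= u n.+1 by rewrite divr_ge0// addr_ge0// ln_nat_ge0.
lra.
Qed.


End Mertens.

(** * Chebyshev's bound through central binomial coefficients *)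

Lemma bin_le_exp2 n m : ('C(n, m) <= 2 ^ n)%N.
Proof.
elim: n m => [|n IH] [|m]; rewrite ?bin0 ?expn_gt0//.
by rewrite binS expnS mul2n -addnn leq_add.
Qed.

Lemma prime_dvd_fact p n : prime p -> (p %| n`!)%N = (p <= n)%N.
Proof.
move=> pp; apply/idP/idP => [|pn]; last by rewrite dvdn_fact// prime_gt0.
elim: n => [|n IH]; first by rewrite dvdn1 => /eqP p1; rewrite p1 in pp.
rewrite factS Euclid_dvdM// => /orP[/dvdn_leq ->//|/IH/leqW//].
Qed.

(** A prime in ]n, 2n] divides (2n)! but not n!, so it divides the binomial coefficient, and
    distinct primes divide it jointly. *)
Lemma prod_primes_le_bin n :
  (\prod_(n.+1 <= p < (n.*2).+1 | prime p) p <= 'C(n.*2, n))%N.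
Proof.
have C0 : (0 < 'C(n.*2, n))%N by rewrite bin_gt0 -addnn leq_addr.
pose A := [set p : 'I_(n.*2).+1 | prime p && (n < p)%N].
have -> : (\prod_(n.+1 <= p < (n.*2).+1 | prime p) p = \prod_(p in A) (p : nat))%N.
  by rewrite big_geq_mkord/= /A big_set.
apply: dvdn_leq => //.
suff : A \subset [set p : 'I_(n.*2).+1 | (p : nat) \in primes 'C(n.*2, n)].
  by rewrite primes_subset_dvd// => /andP[].
apply/fintype.subsetP => p; rewrite !inE mem_primes C0/= => /andP[pp np]; rewrite pp/=.
have : (p %| (n.*2)`!)%N by rewrite prime_dvd_fact// -ltnS.
have n2 : (n <= n.*2)%N by rewrite -addnn leq_addr.
have En : (n.*2 - n = n)%N by rewrite -addnn addnK.
rewrite -(bin_fact n2) !Euclid_dvdM// En prime_dvd_fact//.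
by rewrite leqNgt np !orbF.
Qed.

Section DyadicMertens.
Context {R : realType}.

Lemma ln_expn2 k : ln ((2 ^ k)%:R : R) = k%:R * ln 2.
Proof. by rewrite natrX lnXn// mulr_natl. Qed.

Lemma theta_dyadic_le k :
  \sum_(0 <= p < (2 ^ k).+1 | prime p) ln (p%:R : R) <= 2 * 2 ^+ k * ln 2.
Proof.
elim: k => [|k IH].
  rewrite expn0 big_mkcond/= !big_nat_recr//= big_geq// !addr0.
  by rewrite expr0; have := @ln2_ge_half R; lra.
rewrite (@big_cat_nat _ _ _ (2 ^ k).+1)//=; last by rewrite ltnS leq_exp2l.
have H : \sum_((2 ^ k).+1 <= p < (2 ^ k.+1).+1 | prime p) ln (p%:R : R) <=
   2 ^+ k.+1 * ln 2.
  have P0 : (0 < \prod_((2 ^ k).+1 <= p < (2 ^ k).*2.+1 | prime p) p)%N.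
    by rewrite prodn_cond_gt0// => p /prime_gt0.
  have -> : (2 ^ k.+1 = (2 ^ k).*2)%N by rewrite expnS mul2n.
  have -> : \sum_((2 ^ k).+1 <= p < (2 ^ k).*2.+1 | prime p) ln (p%:R : R) =
      ln (\prod_((2 ^ k).+1 <= p < (2 ^ k).*2.+1 | prime p) p)%:R.
    elim: (index_iota _ _) => [|p s IHs]; first by rewrite !big_nil ln1.
    rewrite !big_cons; case: ifPn => // pp.
    rewrite natrM lnM ?IHs//; rewrite posrE ltr0n; first exact: prime_gt0.
    by rewrite prodn_cond_gt0// => q /prime_gt0.
  have := leq_trans (prod_primes_le_bin (2 ^ k)) (bin_le_exp2 _ _).
  rewrite -(ler_nat R) -ler_ln ?posrE ?ltr0n ?expn_gt0// ln_expn2.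
  by rewrite -mul2n -expnS natrX.
apply: le_trans (lerD IH H) _; rewrite exprS; lra.
Qed.

Definition mertens_sum k : R := \sum_(0 <= p < (2 ^ k).+1 | prime p) ln p%:R / p%:R.

(** With N = 2^k, dropping the floors in log N! = sum of v_p(N!) log p costs at most the sum of log
    p over p <= N, which is O(N) by [theta_dyadic_le]. The converse bound below needs only
    convergence of the sum of log p / (p (p - 1)). *)
Lemma mertens_sum_le k : mertens_sum k <= k%:R * ln 2 + 2 * ln 2.
Proof.
set N := (2 ^ k)%N; have N0 : 0 < N%:R :> R by rewrite ltr0n expn_gt0.
have := @ln_fact_le R N; rewrite ln_fact_primes => H1.
have : N%:R * mertens_sum k - \sum_(0 <= p < N.+1 | prime p) ln (p%:R : R) <=
    N%:R * ln N%:R.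
  apply: le_trans H1; rewrite mulr_sumr -sumrB; apply: ler_sum => p pp.
  rewrite mulrCA -[X in _ - X]mulr1 -mulrBr mulrC ler_wpM2r ?ln_nat_ge0//.
  exact: logn_fact_ge.
rewrite {2}/N ln_expn2 => H2.
have := theta_dyadic_le k; rewrite -/N -natrX -/N => H3.
rewrite -(ler_pM2l N0) mulrDr; lra.
Qed.

Lemma mertens_sum_ge k : k%:R * ln 2 - 4 <= mertens_sum k.
Proof.
set N := (2 ^ k)%N; have N0 : 0 < N%:R :> R by rewrite ltr0n expn_gt0.
have := @ln_fact_ge R N; rewrite ln_fact_primes => H1.
have H2 : \sum_(0 <= p < N.+1 | prime p) (logn p N`!)%:R * ln (p%:R : R) <=
    N%:R * (mertens_sum k + 3).
  apply: (@le_trans _ _ (N%:R * (mertens_sum k +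
      \sum_(0 <= p < N.+1 | prime p) ln (p%:R : R) / (p%:R * (p%:R - 1))))); last first.
    by rewrite ler_pM2l// lerD2l sum_ln_div_sqr.
  rewrite -big_split/= mulr_sumr; apply: ler_sum => p pp.
  have p1 : 1 < p%:R :> R by rewrite ltr1n prime_gt1.
  apply: le_trans (ler_wpM2r (ln_nat_ge0 _) (logn_fact_le N pp)) _.
  rewrite le_eqVlt; apply/orP; left; apply/eqP; field.
  by apply/andP; split; rewrite gt_eqF//; lra.
rewrite -(ler_pM2l N0) -ln_expn2 -/N; lra.
Qed.

Lemma abel_le (f r : nat -> R) B K N : (K <= N)%N ->
  (forall k, (K <= k)%N -> f k.+1 <= f k) -> (forall k, (K <= k)%N -> 0 <= f k) ->
  (forall k, `|r k| <= B) ->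
  \sum_(K <= k < N) (r k.+1 - r k) * f k <= 2 * B * f K.
Proof.
move=> KN fd f0 rB.
(* Summation by parts as an invariant: the boundary term [r N * f N] is kept, and each step costs at
   most B times the decrease of [f], which telescopes. *)
suff : \sum_(K <= k < N) (r k.+1 - r k) * f k <= r N * f N + 2 * B * f K - B * f N.
  move/le_trans; apply; have := ler_wpM2r (f0 N KN) (le_trans (ler_norm _) (rB N)); lra.
rewrite -(subnKC KN); elim: (N - K)%N => [|n IH].
  rewrite addn0 big_geq//; have : - B <= r K by rewrite lerNl (le_trans _ (rB K))// -normrN ler_norm.
  move=> /(ler_wpM2r (f0 K (leqnn K))); lra.
rewrite addnS big_nat_recr ?leq_addr//=; apply: le_trans (lerD IH (lexx _)) _.
have := rB (K + n).+1; have : 0 <= f (K + n)%N - f (K + n).+1 by rewrite subr_ge0 fd// leq_addr.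
move=> fn /(le_trans (ler_norm _))/(ler_wpM2r fn); lra.
Qed.

(** * From Mertens' theorem to sums of p^(-1-s), by dyadic partial summation *)

Definition prime_zeta_sum (K N : nat) (s : R) : R :=
  \sum_((2 ^ K).+1 <= p < (2 ^ N).+1 | prime p) p%:R^-1 * expR (- s * ln p%:R).

Lemma big_dyadic (F : nat -> R) K N : (K <= N)%N ->
  \sum_((2 ^ K).+1 <= p < (2 ^ N).+1 | prime p) F p =
  \sum_(K <= k < N) \sum_((2 ^ k).+1 <= p < (2 ^ k.+1).+1 | prime p) F p.
Proof.
move=> KN; rewrite -(subnKC KN); elim: (N - K)%N => [|n IH].
  by rewrite addn0 !big_geq.
rewrite addnS big_nat_recr ?leq_addr//= -IH -big_cat_nat//= ltnS leq_exp2l//.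
by rewrite leq_addr.
Qed.

(** The value at x = 2^k of x^(-s) / log x, the factor that turns log p / p into p^(-1-s). The [r]
    below is the bounded error in Mertens' theorem. *)
Let f (s : R) k := expR (- (s * ln 2) * k%:R) / (k%:R * ln 2).
Let r k := mertens_sum k - k%:R * ln 2.

Let r_le k : `|r k| <= 4.
Proof.
have := mertens_sum_le k; have := mertens_sum_ge k; have := @ln2_le1 R.
by rewrite /r ler_norml => ? ? ?; apply/andP; split; lra.
Qed.

Let ln2_gt0 : 0 < ln (2 : R).
Proof. by have := @ln2_ge_half R; lra. Qed.

Let f_ge0 s k : 0 <= f s k.
Proof. by rewrite divr_ge0 ?expR_ge0// mulr_ge0// ltW. Qed.

Let f_anti s k : 0 <= s -> (0 < k)%N -> f s k.+1 <= f s k.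
Proof.
move=> s0 k0; apply: ler_pM; rewrite ?expR_ge0 ?invr_ge0 ?mulr_ge0//; try by rewrite ltW.
  by rewrite ler_expR !mulNr lerN2 ler_wpM2l ?ler_nat// mulr_ge0// ltW.
by rewrite lef_pV2 ?posrE ?mulr_gt0 ?ltr0n// ler_wpM2r ?ler_nat// ltW.
Qed.

Let f_le s K : 0 <= s -> (0 < K)%N -> f s K <= 2 / K%:R.
Proof.
move=> s0 K0; have K0' : 0 < K%:R :> R by rewrite ltr0n.
rewrite ler_pdivrMr ?mulr_gt0//.
have -> : 2 / K%:R * (K%:R * ln 2) = 2 * ln (2 : R) by field; rewrite gt_eqF.
apply: (@le_trans _ _ 1); last by have := @ln2_ge_half R; lra.
by rewrite expR_le1 mulNr oppr_le0 !mulr_ge0// ltW.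
Qed.

(** On a dyadic block x^(-s) / log x lies between its values at the two ends, and the sum of log p /
    p over the block is log 2 plus an increment of [r]. *)
Let block k (s : R) : 0 <= s -> (0 < k)%N ->
  (ln 2 + (r k.+1 - r k)) * f s k.+1 <=
  \sum_((2 ^ k).+1 <= p < (2 ^ k.+1).+1 | prime p) p%:R^-1 * expR (- s * ln p%:R) <=
  (ln 2 + (r k.+1 - r k)) * f s k.
Proof.
move=> s0 k0.
have -> : ln 2 + (r k.+1 - r k) =
    \sum_((2 ^ k).+1 <= p < (2 ^ k.+1).+1 | prime p) ln (p%:R : R) / p%:R.
  rewrite /r /mertens_sum (@big_cat_nat _ _ _ (2 ^ k).+1 0 (2 ^ k.+1).+1)//=.
    by rewrite -natr1; ring.
  by rewrite ltnS leq_exp2l.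
have E p : (2 ^ k < p <= 2 ^ k.+1)%N ->
   f s k.+1 * ln p%:R <= expR (- s * ln p%:R) <= f s k * ln p%:R.
  move=> /andP[kp pk]; have p0 : (0 < p)%N by exact: leq_ltn_trans kp.
  have : ln ((2 ^ k)%:R : R) <= ln p%:R.
    by rewrite ler_ln ?posrE ?ltr0n ?expn_gt0// ler_nat ltnW.
  have : ln p%:R <= ln ((2 ^ k.+1)%:R : R).
    by rewrite ler_ln ?posrE ?ltr0n ?expn_gt0// ler_nat.
  rewrite !ln_expn2; set y := ln p%:R => yk ky.
  have kl0 : 0 < k%:R * ln 2 :> R by rewrite mulr_gt0// ltr0n.
  have y0 : 0 <= y by exact: ln_nat_ge0.
  apply/andP; split.
    rewrite /f mulrAC ler_pdivrMr ?mulr_gt0//.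
    apply: ler_pM; rewrite ?expR_ge0//.
    by rewrite ler_expR !mulNr lerN2 -mulrA ler_wpM2l// mulrC.
  rewrite /f mulrAC ler_pdivlMr//.
  apply: ler_pM; rewrite ?expR_ge0 ?(ltW kl0)//.
  by rewrite ler_expR !mulNr lerN2 -mulrA ler_wpM2l// mulrC.
rewrite !mulr_suml; apply/andP; split; rewrite big_nat_cond [leRHS]big_nat_cond.
  apply: ler_sum => p /andP[/E/andP[H _] _].
  by rewrite mulrAC mulrC (mulrC (ln _)) ler_wpM2l.
apply: ler_sum => p /andP[/E/andP[_ H] _].
by rewrite mulrAC [leRHS]mulrC (mulrC (ln _)) ler_wpM2l.
Qed.

Definition exp_harmonic (K N : nat) (t : R) : R :=
  \sum_(K <= k < N) expR (- t * k.+1%:R) / k.+1%:R.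

(** 17 = 2 * 4 * 2 + 1: [abel_le] with |r| <= 4 and f s K <= 2/K gives 16/K, and shifting the index
    from k to k + 1 adds at most 1/K. *)
Lemma prime_zeta_sum_le K N s : (0 < K <= N)%N -> 0 <= s ->
  prime_zeta_sum K N s <= exp_harmonic K N (s * ln 2) + 17 / K%:R.
Proof.
move=> /andP[K0 KN] s0; rewrite /prime_zeta_sum big_dyadic//.
apply: (@le_trans _ _ (\sum_(K <= k < N) (ln 2 * f s k + (r k.+1 - r k) * f s k))).
  apply: ler_sum_nat => k /andP[Kk _].
  by have /andP[_] := block s0 (leq_trans K0 Kk); rewrite mulrDl.
rewrite big_split/=.
have A := abel_le KN (fun k Kk => f_anti s0 (leq_trans K0 Kk)) (fun k _ => f_ge0 s k) r_le.
have fK := f_le s0 K0.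
have : \sum_(K <= k < N) ln 2 * f s k <= exp_harmonic K N (s * ln 2) + K%:R^-1.
  have -> : \sum_(K <= k < N) ln 2 * f s k = \sum_(K <= k < N) expR (- (s * ln 2) * k%:R) / k%:R.
    apply: eq_big_nat => k /andP[Kk _]; rewrite /f; field.
    by rewrite !gt_eqF// ltr0n (leq_trans K0 Kk).
  rewrite /exp_harmonic; have [->|KN'] := eqVneq K N.
    by rewrite !big_geq// add0r invr_ge0.
  have {}KN : (K < N)%N by rewrite ltn_neqAle KN'.
  rewrite big_ltn// addrC; apply: lerD; last first.
    rewrite ler_pdivrMr ?ltr0n// mulVf ?pnatr_eq0 -?lt0n// expR_le1 mulNr oppr_le0.
    by rewrite !mulr_ge0// ltW.
  case: N KN {KN' A} => [//|N]; rewrite ltnS => KN.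
  rewrite big_add1/= big_nat_recr//= lerDl divr_ge0 ?expR_ge0//.
lra.
Qed.

Lemma prime_zeta_sum_ge K N s : (0 < K <= N)%N -> 0 <= s ->
  exp_harmonic K N (s * ln 2) - 16 / K%:R <= prime_zeta_sum K N s.
Proof.
move=> /andP[K0 KN] s0; rewrite /prime_zeta_sum big_dyadic//.
apply: (@le_trans _ _ (\sum_(K <= k < N) (ln 2 * f s k.+1 + (r k.+1 - r k) * f s k.+1))); last first.
  apply: ler_sum_nat => k /andP[Kk _].
  by have /andP[+ _] := block s0 (leq_trans K0 Kk); rewrite mulrDl.
rewrite big_split/=.
(* [abel_le] is one-sided; the lower bound comes from applying it to [- r]. *)
have rN k : `|- r k| <= 4 by rewrite normrN.
have A := abel_le KN (fun k Kk => f_anti s0 (ltn0Sn k)) (fun k _ => f_ge0 s k.+1) rN.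
have fK := le_trans (f_anti s0 K0) (f_le s0 K0).
have -> : \sum_(K <= k < N) ln 2 * f s k.+1 = exp_harmonic K N (s * ln 2).
  apply: eq_big_nat => k _; rewrite /f; field.
  by rewrite gt_eqF//= -natr1 gt_eqF// ltr_wpDl.
have -> : \sum_(K <= k < N) (r k.+1 - r k) * f s k.+1 =
   - \sum_(K <= k < N) (- r k.+1 - - r k) * f s k.+1.
  by rewrite -sumrN; apply: eq_bigr => k _; ring.
lra.
Qed.

End DyadicMertens.

Local Open Scope classical_set_scope.
Local Open Scope ring_scope.

(** * Exponential harmonic sums and Euler products *)

Section LogSeries.
Context {R : realType}.

(** Mean value theorem for the truncated series plus log (1 - y): the derivative is exactly -y^N /
    (1 - y), which is monotone on [0, x]. *)
Lemma ln_series_bounds (x : R) N : 0 < x < 1 ->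
  - ln (1 - x) - x ^+ N / (1 - x) <= \sum_(0 <= k < N) x ^+ k.+1 / k.+1%:R
  <= - ln (1 - x).
Proof.
move=> /andP[x0 x1].
pose p : {poly R} := \sum_(k < N) k.+1%:R^-1 *: 'X^(k.+1).
have pE y : p.[y] = \sum_(0 <= k < N) y ^+ k.+1 / k.+1%:R.
  rewrite big_mkord horner_sum; apply: eq_bigr => k _.
  by rewrite hornerZ hornerXn mulrC.
have dpE y : y != 1 -> p^`().[y] = (1 - y ^+ N) / (1 - y).
  move=> y1; have -> : p^`().[y] = \sum_(i < N) y ^+ i.
    rewrite /p raddf_sum horner_sum; apply: eq_bigr => k _.
    rewrite /= derivZ derivXn hornerZ hornerMn hornerXn /=.
    by rewrite -[y ^+ k *+ _]mulr_natl mulrA mulVf ?mul1r// pnatr_eq0.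
  have := subrX1 y N => H; rewrite -opprB H -(opprB y 1) invrN mulrNN.
  by rewrite mulrAC divff ?mul1r// subr_eq0.
pose g := (fun y : R => p.[y] + ln (1 - y)).
have dg (y : R) : y < 1 -> is_derive y 1 g (p^`().[y] - (1 - y)^-1).
  move=> y1.
  have d1 : is_derive y 1 (fun z : R => 1 - z) (-1).
    by apply: is_derive_eq; rewrite add0r mul1r.
  have d2 : is_derive (1 - y) 1 (@ln R) (1 - y)^-1.
    by apply: is_derive1_ln; rewrite subr_gt0.
  have d3 := @is_derive1_comp R (@ln R) (fun z : R => 1 - z) y _ _ d2 d1.
  have -> : g = horner p + (@ln R \o (fun z : R => 1 - z)) by apply/funext.
  by apply: is_derive_eq; rewrite ?mulrN1 ?mulN1r ?scaleN1r.
have [c] : exists2 c, c \in `]0, x[ & g x - g 0 = (p^`().[c] - (1 - c)^-1) * (x - 0).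
  apply: (@MVT _ g (fun c => p^`().[c] - (1 - c)^-1)) => //.
    by move=> y; rewrite in_itv/= => /andP[_ yx]; apply: dg; rewrite (lt_trans yx).
  apply: derivable_within_continuous => y; rewrite in_itv/= => /andP[_ yx].
  by have [] := dg y (le_lt_trans yx x1).
rewrite in_itv/= => /andP[c0 cx]; have c1 := lt_trans cx x1.
have -> : g 0 = 0.
  rewrite /g subr0 ln1 addr0 pE big1// => k _.
  by rewrite expr0n mul0r.
have D : (1 - c ^+ N) / (1 - c) - (1 - c)^-1 = - (c ^+ N / (1 - c)).
  by rewrite mulrBl mul1r addrAC subrr sub0r.
rewrite !subr0 dpE ?lt_eqF// D /g pE => E.
have cN : 0 <= c ^+ N / (1 - c) <= x ^+ N / (1 - x).
  apply/andP; split; first by rewrite divr_ge0 ?exprn_ge0 ?subr_ge0 ?(ltW c0) ?(ltW c1).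
  apply: ler_pM; rewrite ?exprn_ge0 ?invr_ge0 ?subr_ge0 ?(ltW c0) ?(ltW c1)//.
    by rewrite lerXn2r ?nnegrE ?ltW.
  by rewrite lef_pV2 ?posrE ?subr_gt0// lerD2l lerN2 ltW.
set S := \sum_(_ <= _ < _) _ in E *; set z := c ^+ N / (1 - c) in E cN.
have /andP[z0 zx] := cN.
have : z * x <= z by rewrite ler_piMr// ltW.
have : 0 <= z * x by rewrite mulr_ge0// ltW.
by move=> ? ?; apply/andP; split; lra.
Qed.

(** [limn] has this meaning only once the sequence is known to converge, which follows from
    monotonicity and a lower bound. *)
Lemma harmonic_sub_ln_cvg :
  (fun n : nat => series (@harmonic R) n - ln n%:R) @ \oo --> euler_gamma R.
Proof.
pose a n : R := series (@harmonic R) n - ln n%:R.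
suff : cvgn a by [].
(* The shift is needed: with ln 0 = 0 the sequence starts at a 0 = 0 < a 1 = 1, and decreases only
   from there on. *)
suff : cvgn [sequence a (n + 1)%N]_n.
  by move=> /cvg_ex[l]; rewrite cvg_shiftn => al; apply/cvg_ex; exists l.
apply: nonincreasing_is_cvgn.
  apply/nonincreasing_seqP => n; rewrite /= !addn1 /a /series/= big_nat_recr//=.
  by rewrite -!addrA lerD2l lerBlDr addrC lerBrDl; exact: ln_natS_ge.
have lnH n : ln n.+1%:R <= series (@harmonic R) n.
  elim: n => [|n IH]; first by rewrite /series/= big_geq// ln1.
  rewrite /series/= big_nat_recr//=; apply: le_trans (ln_natS_le (ltn0Sn n)) _.
  by rewrite lerD2r.
exists 0 => _ [n _ <-]; rewrite /= addn1 /a subr_ge0 (le_trans _ (lnH n.+1))//.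
by rewrite ler_ln ?posrE ?ltr0n// ler_nat.
Qed.

Lemma harmonic_near (e : R) : 0 < e -> exists K0 : nat, forall K, (K0 <= K)%N ->
  `|series (@harmonic R) K - ln K%:R - euler_gamma R| <= e.
Proof.
move=> e0; have /cvgrPdist_le/(_ e e0)[K0 _ H] := harmonic_sub_ln_cvg.
by exists K0 => K KK; rewrite distrC; exact: H.
Qed.

Lemma exp_harmonicE K N (t : R) : (K <= N)%N ->
  exp_harmonic K N t = exp_harmonic 0 N t - exp_harmonic 0 K t.
Proof.
move=> KN; rewrite /exp_harmonic [X in _ = X - _](@big_cat_nat _ _ _ K)//=.
by rewrite addrAC subrr add0r.
Qed.

Lemma exp_harmonic0_bounds N (t : R) : 0 < t ->
  - ln t - expR (- t * N%:R) * ((1 + t) / t) <= exp_harmonic 0 N t <= - ln t + t.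
Proof.
move=> t0; pose x := expR (- t).
have x01 : 0 < x < 1 by rewrite expR_gt0 expR_lt1 oppr_lt0.
(* The series in x = exp (-t) sums to -log (1 - x), and 1 - x is t up to a factor 1 + t. *)
have xlb : t / (1 + t) <= 1 - x.
  have := expR_ge1Dx t => H; rewrite /x expRN.
  have t10 : 0 < 1 + t by lra.
  have : (expR t)^-1 <= (1 + t)^-1 by rewrite lef_pV2 ?posrE ?expR_gt0.
  have -> : t / (1 + t) = 1 - (1 + t)^-1 by field; rewrite gt_eqF.
  lra.
have xub : 1 - x <= t by have := expR_ge1Dx (- t); rewrite -/x; lra.
have tt : 0 < t / (1 + t) by rewrite divr_gt0//; lra.
have x10 : 0 < 1 - x by lra.
have -> : exp_harmonic 0 N t = \sum_(0 <= k < N) x ^+ k.+1 / k.+1%:R.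
  by apply: eq_bigr => k _; rewrite expRM_natr.
have /andP[lo up] := ln_series_bounds N x01.
have lnlo : ln t - t <= ln (1 - x).
  apply: (@le_trans _ _ (ln (t / (1 + t)))); last by rewrite ler_ln// posrE.
  rewrite ln_div ?posrE//; last by lra.
  by rewrite lerD2l lerN2 le_ln1Dx//; lra.
have lnup : ln (1 - x) <= ln t by rewrite ler_ln ?posrE.
have tail : x ^+ N / (1 - x) <= expR (- t * N%:R) * ((1 + t) / t).
  rewrite expRM_natr ler_wpM2l ?exprn_ge0 ?expR_ge0//.
  by rewrite -invf_div lef_pV2 ?posrE.
by apply/andP; split; lra.
Qed.

Lemma exp_harmonic0_le N (t : R) : 0 <= t ->
  series (@harmonic R) N - t * N%:R <= exp_harmonic 0 N t <= series (@harmonic R) N.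
Proof.
move=> t0; rewrite /series/= /exp_harmonic.
have F k : k.+1%:R^-1 - t <= expR (- t * k.+1%:R) / k.+1%:R <= k.+1%:R^-1.
  have k0 : 0 < k.+1%:R :> R by rewrite ltr0n.
  apply/andP; split; last first.
    by rewrite ler_piMl ?invr_ge0// expR_le1 mulNr oppr_le0 mulr_ge0.
  rewrite ler_pdivlMr// mulrBl mulVf ?gt_eqF//.
  by have := expR_ge1Dx (- t * k.+1%:R); rewrite mulNr.
apply/andP; split; last by apply: ler_sum => k _; have /andP[] := F k.
have -> : t * N%:R = \sum_(0 <= k < N) t by rewrite sumr_const_nat subn0 mulr_natr.
by rewrite -sumrB; apply: ler_sum => k _; have /andP[] := F k.
Qed.

(* Since the primes up to [2 ^ K] are left out, the constant is Euler's gamma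
   coming from the harmonic sums: no form of Mertens' third theorem is needed. *)
Lemma prime_zeta_sum_upper K N (s : R) : (0 < K <= N)%N -> 0 < s ->
  prime_zeta_sum K N s <= - ln (s * ln 2) + s * ln 2 * K.+1%:R
    - series (@harmonic R) K + 17 / K%:R.
Proof.
move=> KN s0; have l2 : 0 < ln (2 : R) by have := @ln2_ge_half R; lra.
have t0 : 0 < s * ln 2 by rewrite mulr_gt0.
have := prime_zeta_sum_le KN (ltW s0).
have /andP[_ KN'] := KN; rewrite exp_harmonicE//.
have /andP[_] := exp_harmonic0_bounds N t0.
have /andP[+ _] := exp_harmonic0_le K (ltW t0).
rewrite -natr1; lra.
Qed.

Lemma prime_zeta_sum_lower K N (s : R) : (0 < K <= N)%N -> 0 < s ->
  - ln (s * ln 2) - series (@harmonic R) K - 16 / K%:R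
    - expR (- (s * ln 2) * N%:R) * ((1 + s * ln 2) / (s * ln 2))
  <= prime_zeta_sum K N s.
Proof.
move=> KN s0; have l2 : 0 < ln (2 : R) by have := @ln2_ge_half R; lra.
have t0 : 0 < s * ln 2 by rewrite mulr_gt0.
have := prime_zeta_sum_ge KN (ltW s0).
have /andP[_ KN'] := KN; rewrite exp_harmonicE//.
have /andP[+ _] := exp_harmonic0_bounds N t0.
have /andP[_] := exp_harmonic0_le K (ltW t0).
lra.
Qed.

Lemma ln_prod (I : Type) (r : seq I) (P : pred I) (F : I -> R) :
  (forall i, P i -> 0 < F i) ->
  ln (\prod_(i <- r | P i) F i) = \sum_(i <- r | P i) ln (F i).
Proof.
move=> F0; suff [] : 0 < \prod_(i <- r | P i) F i /\
    ln (\prod_(i <- r | P i) F i) = \sum_(i <- r | P i) ln (F i) by [].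
elim/big_rec2: _ => [|i y z Pi [z0 zE]]; first by rewrite ln1.
by rewrite mulr_gt0 ?F0// lnM ?posrE ?F0// zE.
Qed.

Lemma euler_factor_ge1 j p (s : R) : 1 <= 1 + j%:R / p%:R * expR (- s * ln p%:R).
Proof. by rewrite lerDl mulr_ge0 ?expR_ge0// divr_ge0. Qed.

Lemma euler_prod_gt0 j M (s : R) : 0 < euler_prod j M s.
Proof. by apply: prodr_gt0 => p _; rewrite (lt_le_trans _ (euler_factor_ge1 _ _ _)). Qed.

Lemma ln_euler_prodE j K N (s : R) : (K <= N)%N ->
  ln (euler_prod j (2 ^ N).+1 s) =
  \sum_(0 <= p < (2 ^ K).+1 | prime p) ln (1 + j%:R / p%:R * expR (- s * ln p%:R)) +
  \sum_((2 ^ K).+1 <= p < (2 ^ N).+1 | prime p) ln (1 + j%:R / p%:R * expR (- s * ln p%:R)).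
Proof.
move=> KN; rewrite -big_cat_nat//=; last by rewrite ltnS leq_exp2l.
rewrite /euler_prod ln_prod; first by rewrite big_mkord.
by move=> p _; rewrite (lt_le_trans _ (euler_factor_ge1 _ _ _)).
Qed.

(** Up to 2^K every factor is bounded trivially by j + 1; beyond, log (1 + x) <= x. *)
Lemma ln_euler_prod_le j K N (s : R) : (K <= N)%N -> 0 <= s ->
  ln (euler_prod j (2 ^ N).+1 s) <=
    (2 ^ K)%:R * ln j.+1%:R + j%:R * prime_zeta_sum K N s.
Proof.
move=> KN s0; rewrite (ln_euler_prodE _ _ KN); apply: lerD.
  rewrite big_ltn_cond//=.
  have -> : (2 ^ K)%:R * ln j.+1%:R = \sum_(1 <= p < (2 ^ K).+1) ln j.+1%:R :> R.
    by rewrite sumr_const_nat subSS subn0 mulr_natl.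
  rewrite big_mkcond/=; apply: ler_sum_nat => p /andP[p0 _].
  case: ifP => _; last exact: ln_nat_ge0.
  rewrite ler_ln ?posrE ?ltr0n ?(lt_le_trans _ (euler_factor_ge1 _ _ _))//.
  rewrite -natr1 [leRHS]addrC lerD2l -[leRHS]mulr1; apply: ler_pM; rewrite ?expR_ge0 ?divr_ge0//.
    by rewrite ler_pdivrMr ?ltr0n// ler_peMr// ler1n.
  by rewrite expR_le1 mulNr oppr_le0 mulr_ge0 ?ln_nat_ge0.
rewrite mulr_sumr; apply: ler_sum => p _; rewrite mulrA.
apply: le_ln1Dx; apply: (@lt_le_trans _ _ 0); first by lra.
by rewrite mulr_ge0 ?expR_ge0// divr_ge0.
Qed.

Lemma ln1D_ge (x : R) : 0 <= x -> x - x ^+ 2 <= ln (1 + x).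
Proof.
move=> x0; have x10 : 0 < 1 + x by lra.
apply: le_trans (ln_ge_1subV x10).
have -> : 1 - (1 + x)^-1 = x / (1 + x) by field; rewrite gt_eqF.
rewrite ler_pdivlMr// -subr_ge0.
have -> : x - (x - x ^+ 2) * (1 + x) = x ^+ 3 by ring.
by rewrite exprn_ge0.
Qed.

Lemma sum_invsqr_le a b : (0 < a)%N ->
  \sum_(a.+1 <= n < b) (n%:R ^+ 2)^-1 <= a%:R^-1 :> R.
Proof.
move=> a0; have [ab|ba] := leqP a.+1 b; last first.
  by rewrite big_geq ?invr_ge0// ltnW.
apply: (@le_trans _ _ (\sum_(a.+1 <= n < b) (- n%:R^-1 - - n.-1%:R^-1))).
  apply: ler_sum_nat => -[//|n] /andP[an _] /=.
  have n0 : 0 < n%:R :> R by rewrite ltr0n (leq_trans a0).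
  rewrite -natr1; set m : R := n%:R.
  have -> : - (m + 1)^-1 - - m^-1 = (m * (m + 1))^-1.
    by field; apply/andP; split; rewrite gt_eqF//; rewrite -/m in n0; lra.
  rewrite -/m in n0; have m1 : 0 < m + 1 by lra.
  rewrite lef_pV2 ?posrE; [|exact: exprn_gt0|exact: mulr_gt0].
  by rewrite expr2 ler_pM2r//; lra.
rewrite big_add1 /= telescope_sumr; last by rewrite -ltnS prednK// (leq_trans _ ab).
have : 0 <= b.-1%:R^-1 :> R by rewrite invr_ge0.
lra.
Qed.

(** The factors up to 2^K are at least 1 and are dropped; beyond, log (1 + x) >= x - x^2, and the
    squares j^2/p^2 add up to at most j^2 / 2^K. *)
Lemma ln_euler_prod_ge j K N (s : R) : (K <= N)%N -> 0 <= s ->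
  j%:R * prime_zeta_sum K N s - j%:R ^+ 2 / (2 ^ K)%:R <=
  ln (euler_prod j (2 ^ N).+1 s).
Proof.
move=> KN s0; rewrite (ln_euler_prodE _ _ KN) -[leLHS]add0r; apply: lerD.
  by apply: sumr_ge0 => p _; rewrite ln_ge0// euler_factor_ge1.
apply: (@le_trans _ _ (j%:R * prime_zeta_sum K N s -
   j%:R ^+ 2 * \sum_((2 ^ K).+1 <= p < (2 ^ N).+1) (p%:R ^+ 2)^-1)).
  by rewrite lerD2l lerN2 ler_wpM2l ?exprn_ge0// sum_invsqr_le// expn_gt0.
apply: (@le_trans _ _ (j%:R * prime_zeta_sum K N s -
   j%:R ^+ 2 * \sum_((2 ^ K).+1 <= p < (2 ^ N).+1 | prime p) (p%:R ^+ 2)^-1)).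
  rewrite lerD2l lerN2 ler_wpM2l ?exprn_ge0// big_mkcond/=.
  by apply: ler_sum => p _; case: ifP => // _; rewrite invr_ge0 exprn_ge0.
rewrite !mulr_sumr -sumrB; apply: ler_sum => p _.
set e := expR _; have e0 : 0 <= e by exact: expR_ge0.
have e1 : e <= 1 by rewrite expR_le1 mulNr oppr_le0 mulr_ge0// ln_nat_ge0.
apply: le_trans (ln1D_ge _); last by rewrite mulr_ge0// divr_ge0.
rewrite mulrA lerD2l lerN2 !exprMn exprVn; apply: ler_piMr.
  by rewrite mulr_ge0 ?invr_ge0 ?exprn_ge0.
by rewrite exprn_ile1.
Qed.

End LogSeries.

(** * Uniform asymptotics of the prime sums *)

Section Eventually.
Context {R : realType}.
Local Notation gamma := (euler_gamma R).

Lemma near_pinfty_ge (C : R) : \forall l \near (+oo : set_system R), C <= l.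
Proof. by apply: nbhs_pinfty_ge; rewrite num_real. Qed.

Lemma near_sqr_le_expR (a C : R) : 0 < a ->
  \forall l \near (+oo : set_system R), C * l ^+ 2 <= expR (a * l).
Proof.
move=> a0; near=> l.
have l0 : 0 <= l by near: l; exact: near_pinfty_ge.
have H := expR_ge1Dxn 2 (mulr_ge0 (ltW a0) l0).
apply: le_trans _ H.
have lC : C * 6 / a ^+ 3 <= l by near: l; exact: near_pinfty_ge.
have a3 : 0 < a ^+ 3 by rewrite exprn_gt0.
rewrite ler_pdivrMr// in lC.
apply: ler_wpDl => //; rewrite ler_pdivlMr ?ltr0n ?fact_gt0//.
have -> : (3`!)%:R = 6 :> R by [].
rewrite exprMn (exprS l) mulrA -mulrAC.
have := ler_wpM2r (sqr_ge0 l) lC; lra.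
Unshelve. all: by end_near. Qed.

Lemma near_truncn_ge (a : R) (n : nat) : 0 < a ->
  \forall l \near (+oo : set_system R), (n <= Num.truncn (a * l))%N.
Proof.
move=> a0; near=> l.
have l0 : 0 <= l by near: l; exact: near_pinfty_ge.
rewrite truncn_ge_nat; last by rewrite mulr_ge0 ?(ltW a0).
rewrite mulrC -(ler_pdivrMr _ _ a0); near: l; exact: near_pinfty_ge.
Unshelve. all: by end_near. Qed.

(** 18 is the 17 of [prime_zeta_sum_upper] plus 1 for passing from log K to log (K + 1). *)
Lemma harmonic_near_le (e : R) : 0 < e -> exists2 K0 : nat, (0 < K0)%N &
  forall K, (K0 <= K)%N -> ln K%:R + gamma - e <= series (@harmonic R) K - 18 / K%:R /\
     series (@harmonic R) K + 17 / K%:R <= ln K%:R + gamma + e.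
Proof.
move=> e0; have e20 : 0 < e / 2 by rewrite divr_gt0.
have [K0 H] := harmonic_near e20.
exists (maxn K0 (Num.truncn (36 / e)).+1); first by rewrite leq_max orbT.
move=> K; rewrite geq_max => /andP[/H + KK].
have K1 : (0 < K)%N by exact: leq_ltn_trans KK.
have : 18 / K%:R <= e / 2.
  rewrite ler_pdivrMr ?ltr0n// mulrC -ler_pdivrMr//.
  have := truncnS_gt (36 / e); rewrite -(ler_nat R) in KK.
  have -> : 18 / (e / 2) = 36 / e by field; rewrite gt_eqF.
  lra.
have : 0 < K%:R^-1 :> R by rewrite invr_gt0 ltr0n.
rewrite ler_norml => ? ? /andP[? ?]; split; lra.
Qed.

(** Here 2^K is about exp (k l) with k = exp (-e)/2 < 1/2, so log log 2^K is about log l - log 2 -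
    e: this is where [ln 2] comes from. The range of [s] is that of m / exp l for m = O(exp (l/2)),
    which makes s * K negligible. *)
Lemma near_prime_zeta_upper (e D : R) : 0 < e -> 0 < D ->
  \forall l \near (+oo : set_system R),
    let K := Num.truncn (expR (- e) / 2 / ln 2 * l) in
    [/\ (0 < K)%N, (2 ^ K)%:R <= expR (expR (- e) / 2 * l) &
     forall N s, (K <= N)%N -> 0 < s <= D * expR (- (l / 2)) ->
       prime_zeta_sum K N s <= - ln s - ln l + ln 2 - gamma + 3 * e].
Proof.
move=> e0 D0; have l20 : 0 < ln (2 : R) by have := @ln2_ge_half R; lra.
set k := expR (- e) / 2; have k0 : 0 < k by rewrite divr_gt0 ?expR_gt0.
have [K0 K00 HK0] := harmonic_near_le e0.
have kl0 : 0 < k / ln 2 by rewrite divr_gt0.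
near=> l.
have l1 : 1 <= l by near: l; exact: near_pinfty_ge.
have l0 : 0 < l by lra.
set K := Num.truncn _ => /=.
have KK0 : (K0 <= K)%N by rewrite /K; near: l; exact: near_truncn_ge.
have K1 : (0 < K)%N by exact: leq_trans KK0.
have Kl : K%:R * ln 2 <= k * l.
  have : K%:R <= k / ln 2 * l by rewrite /K truncn_le mulr_ge0 ?(ltW kl0)//; lra.
  by rewrite mulrAC ler_pdivlMr.
split=> //; first by rewrite -ler_ln ?posrE ?expR_gt0 ?ltr0n ?expn_gt0// expRK ln_expn2.
move=> N s KN /andP[s0 sD]; apply: le_trans (prime_zeta_sum_upper _ s0) _; first by rewrite K1.
have [H _] := HK0 K KK0.
have := ln_natS_le K1 (R := R) => HS.
have HKS : ln (k / ln 2 * l) <= ln (K.+1%:R : R).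
  have A : 0 < k / ln 2 * l by rewrite mulr_gt0//; lra.
  by rewrite ler_ln ?posrE ?ltr0n//; apply: ltW; exact: truncnS_gt.
rewrite lnM ?posrE// in HKS.
rewrite ln_div ?posrE// in HKS.
have kE : ln k = - e - ln 2 by rewrite ln_div ?posrE ?expR_gt0// expRK.
rewrite lnM ?posrE//.
have : s * ln 2 * K.+1%:R <= e.
  rewrite -[K.+1%:R]natr1 -mulrA; apply: (@le_trans _ _ (D * expR (- (l / 2)) * (2 * l))).
    have k2 : k <= 2^-1.
      by rewrite ler_pdivrMr// mulVf// expR_le1 oppr_le0 ltW.
    apply: ler_pM => //; first exact: ltW.
      by rewrite mulr_ge0 ?(ltW l20)//; have := ltr0n R K; lra.
    have := @ln2_le1 R; have : k * l <= 2^-1 * l by rewrite ler_pM2r//; lra.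
    rewrite mulrDr mulr1 [ln 2 * _]mulrC; lra.
  have F : D * 2 / e * l ^+ 2 <= expR (2^-1 * l) by near: l; apply: near_sqr_le_expR; lra.
  rewrite expRN; have -> : l / 2 = 2^-1 * l by rewrite mulrC.
  rewrite mulrAC ler_pdivrMr ?expR_gt0//.
  have F' : D * 2 / e * l <= expR (2^-1 * l).
    apply: le_trans F; rewrite expr2 mulrA ler_peMr// !mulr_ge0 ?invr_ge0 ?(ltW D0) ?(ltW e0)//; lra.
  have := ler_wpM2l (ltW e0) F'.
  have -> : e * (D * 2 / e * l) = D * (2 * l) by field; rewrite gt_eqF.
  by [].
lra.
Unshelve. all: by end_near. Qed.

(** The mirror image with k = exp e / 2 > 1/2. [N0] depends on [s] because the sum stops at 2^N and
    the missing tail is small only once s * N is large. *)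
Lemma near_prime_zeta_lower (e : R) : 0 < e ->
  \forall l \near (+oo : set_system R),
    let K := (Num.truncn (expR e / 2 / ln 2 * l)).+1 in
    expR (expR e / 2 * l) <= (2 ^ K)%:R /\
    forall s, 0 < s -> exists N0, forall N, (N0 <= N)%N -> (K <= N)%N /\
      - ln s - ln l + ln 2 - gamma - 4 * e <= prime_zeta_sum K N s.
Proof.
move=> e0; have l20 : 0 < ln (2 : R) by have := @ln2_ge_half R; lra.
set k := expR e / 2; have k0 : 0 < k by rewrite divr_gt0 ?expR_gt0.
have [K0 K00 HK0] := harmonic_near_le e0.
have kl0 : 0 < k / ln 2 by rewrite divr_gt0.
near=> l.
have l1 : 1 <= l by near: l; exact: near_pinfty_ge.
have l0 : 0 < l by lra.
set J := Num.truncn _ => /=.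
have KK0 : (K0 <= J)%N by rewrite /J; near: l; exact: near_truncn_ge.
have J1 : (0 < J)%N by exact: leq_trans KK0.
have A : 0 < k / ln 2 * l by rewrite mulr_gt0//; lra.
split.
  rewrite -ler_ln ?posrE ?expR_gt0 ?ltr0n ?expn_gt0// expRK ln_expn2.
  have : k / ln 2 * l <= J.+1%:R by apply: ltW; exact: truncnS_gt.
  by rewrite mulrAC ler_pdivrMr.
move=> s s0; set t := s * ln 2; have t0 : 0 < t by rewrite mulr_gt0.
set C := (1 + t) / t; have C0 : 0 < C by rewrite divr_gt0//; lra.
exists (maxn J.+1 (Num.truncn (C / e / t)).+1) => N; rewrite geq_max => /andP[JN tN].
split=> //; apply: le_trans (prime_zeta_sum_lower _ s0); last by rewrite JN.
have [_ H] := HK0 J.+1 (leqW KK0); have [H' _] := HK0 J KK0.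
have HS := ln_natS_le J1 (R := R).
have HJ : ln J%:R <= ln (k / ln 2 * l).
  by rewrite ler_ln ?posrE ?ltr0n// truncn_le ltW.
rewrite lnM ?posrE// in HJ.
rewrite ln_div ?posrE// in HJ.
have kE : ln k = e - ln 2 by rewrite ln_div ?posrE ?expR_gt0// expRK.
have JV : 0 <= J.+1%:R^-1 :> R by rewrite invr_ge0.
have J18 : J%:R^-1 <= e.
  have [H1 H2] := HK0 J KK0; have : 0 <= J%:R^-1 :> R by rewrite invr_ge0.
  lra.
have tail : expR (- t * N%:R) * C <= e.
  rewrite mulNr expRN mulrC ler_pdivrMr ?expR_gt0// mulrC -ler_pdivrMr//.
  have := expR_ge1Dx (t * N%:R).
  have : C / e <= t * N%:R.
    rewrite [t * _]mulrC -ler_pdivrMr//.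
    by apply: le_trans (ltW (truncnS_gt _)) _; rewrite ler_nat.
  lra.
rewrite -/t -/C; have -> : ln t = ln s + ln (ln 2) by rewrite lnM ?posrE.
move: H HS JV; set v := _^-1; set hJ := series _ _; set lJ := ln J.+1%:R => H HS JV.
lra.
Unshelve. all: by end_near. Qed.

End Eventually.

(** * Upper bound *)

Section UpperBound.
Context {R : realType}.
Local Notation gamma := (euler_gamma R).

Definition sum_expn_omega_below (r X : nat) : R :=
  \sum_(1 <= n < X.+1) r%:R ^+ size (primes n).

Lemma sum_factorizations_le X m : (X < 2 ^ m)%N ->
  \sum_(1 <= n < X.+1) (nb_coprime_factorizations n)%:R <=
  \sum_(r < m) sum_expn_omega_below r X / r`!%:R.
Proof.
move=> Xm; rewrite /sum_expn_omega_below.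
under [leRHS]eq_bigr do rewrite mulr_suml.
rewrite exchange_big/=; apply: ler_sum_nat => n /andP[n0 nX].
have nm : (n < 2 ^ m)%N by exact: leq_ltn_trans Xm.
rewrite (nb_factorizations_split n0 nm) natr_sum; apply: ler_sum => r _.
rewrite ler_pdivlMr ?ltr0n ?fact_gt0// -natrX -natrM ler_nat.
exact: card_factorizations_size_le.
Qed.

(** The maximum over r is attained at r = exp (a/2); the bound is log y <= y - 1 at y = exp (a/2) /
    r. *)
Lemma maximum_ineq (r a : R) : 0 < r -> r * (2 + a - 2 * ln r) <= 2 * expR (a / 2).
Proof.
move=> r0; have E0 := expR_gt0 (a / 2).
have := @ln_le_sub1 R (expR (a / 2) / r); rewrite divr_gt0// => /(_ isT).
rewrite ln_div ?posrE// expRK => H.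
have := ler_wpM2l (ltW r0) H; rewrite mulrBr (mulrBr r (_ / r)) [r * (_ / r)]mulrC divfK ?gt_eqF//.
lra.
Qed.

(** Rankin's parameter is s = r / L. Of the 2r in the exponent, one r is s * L and the other comes
    from r! >= (r/e)^r. *)
Lemma sum_expn_omega_below_le K N r X (L W : R) : (0 < X <= 2 ^ N)%N -> (K <= N)%N ->
  (0 < r)%N -> 0 < L -> ln X%:R <= L -> prime_zeta_sum K N (r%:R / L) <= W ->
  sum_expn_omega_below r X / r`!%:R <=
  expR L * expR ((2 ^ K)%:R * ln r.+1%:R + r%:R * (2 - ln r%:R + W)).
Proof.
move=> /andP[X0 XN] KN r0 L0 XL HW; set s := r%:R / L in HW *.
have r0' : 0 < r%:R :> R by rewrite ltr0n.
have s0 : 0 <= s by rewrite divr_ge0// ltW.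
have XN' : (0 < X < (2 ^ N).+1)%N by rewrite X0.
have f0 : 0 < r`!%:R :> R by rewrite ltr0n fact_gt0.
rewrite ler_pdivrMr//.
apply: (@le_trans _ _ (\sum_(1 <= n < X.+1) (r.+1%:R : R) ^+ size (primes n))).
  by apply: ler_sum => n _; rewrite lerXn2r ?nnegrE// ler_nat.
apply: le_trans (sum_expn_omega_le r XN' s0) _.
have -> : X%:R = expR (ln X%:R) :> R by rewrite lnK// posrE ltr0n.
rewrite expRK.
have -> : euler_prod r (2 ^ N).+1 s = expR (ln (euler_prod r (2 ^ N).+1 s)).
  by rewrite lnK// posrE euler_prod_gt0.
have -> : r`!%:R = expR (ln r`!%:R) :> R by rewrite lnK.
rewrite -!expRD ler_expR.
have := ln_euler_prod_le r KN s0; have := ln_fact_ge (R := R) r.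
have := ler_wpM2l (ltW r0') HW; have := ler_wpM2l s0 XL.
have -> : s * L = r%:R by rewrite /s divfK// gt_eqF.
lra.
Qed.

(** Far beyond the maximum the crude cut K = 1 suffices. With 11 the coefficient of r is at most 20
    - 2 * 11 = -2, which offsets the 2 log (r + 1) <= 2r of the small primes. *)
Lemma term_le_large N r X (l : R) : (0 < X <= 2 ^ N)%N -> (0 < N)%N ->
  (0 < r)%N -> ln X%:R <= expR l -> r%:R * ln 2 <= expR l ->
  expR (11 - ln (ln 2) / 2) * expR (l / 2) <= r%:R ->
  sum_expn_omega_below r X / r`!%:R <= expR (expR l).
Proof.
move=> XN N0 r0 Xl rl rD; have r0' : 0 < r%:R :> R by rewrite ltr0n.
have l2 : 0 < ln (2 : R) by have := @ln2_ge_half R; lra.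
have s0 : 0 < r%:R / expR l by rewrite divr_gt0 ?expR_gt0.
have K1 : (0 < 1 <= N)%N by [].
apply: le_trans (sum_expn_omega_below_le XN N0 r0 (expR_gt0 l) Xl
  (prime_zeta_sum_upper K1 s0)) _.
rewrite ler_piMr ?expR_ge0// expR_le1 expn1.
have -> : series (@harmonic R) 1 = 1 by rewrite /series/= big_nat1 invr1.
rewrite lnM ?posrE// ln_div ?posrE ?expR_gt0// expRK divr1.
have H1 : ln (r.+1%:R : R) <= r%:R.
  by have := @ln_le_sub1 R r.+1%:R; rewrite ltr0n -natr1 addrK; apply.
have H2 : r%:R / expR l * ln 2 <= 1 by rewrite mulrAC ler_pdivrMr ?expR_gt0// mul1r.
have H3 : 11 - ln (ln 2) / 2 + l / 2 <= ln (r%:R : R).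
  by rewrite -ler_expR lnK ?posrE// expRD.
have : r%:R * (2 - ln r%:R + (- (ln r%:R - l + ln (ln 2)) + r%:R / expR l * ln 2 * 2 - 1 + 17))
    <= r%:R * (- 2) by rewrite ler_pM2l//; lra.
lra.
Qed.

Lemma ln_natS_le_half_expR (D l : R) (r : nat) : 0 < D -> 1 <= l ->
  (D + 1) * l ^+ 2 <= expR (l / 2) -> r%:R <= D * expR (l / 2) -> ln (r.+1%:R : R) <= l.
Proof.
move=> D0 l1 F rD; rewrite -[leRHS]expRK ler_ln ?posrE ?ltr0n ?expR_gt0// -natr1.
have -> : expR l = expR (l / 2) * expR (l / 2) by rewrite -expRD -splitr.
have F1 : D + 1 <= expR (l / 2).
  by apply: le_trans F; rewrite ler_peMr ?expr2 ?mulr_ege1//; lra.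
have := ler_wpM2r (expR_ge0 (l / 2)) F1.
have : 1 <= expR (l / 2) by rewrite expR_ge1; lra.
lra.
Qed.

Lemma expR_half_ln_le (l : R) : 1 <= l -> expR (ln l / 2) <= l.
Proof.
move=> l1; rewrite -[leRHS]lnK ?posrE; last by lra.
by rewrite ler_expR; have := ln_ge0 l1; lra.
Qed.

Lemma near_term_le_small (e D : R) : 0 < e -> 0 < D ->
  \forall l \near (+oo : set_system R), forall N0 r X, (0 < X <= 2 ^ N0)%N -> (0 < r)%N ->
    ln X%:R <= expR l -> r%:R <= D * expR (l / 2) ->
    sum_expn_omega_below r X / r`!%:R <= expR (expR l) *
      expR (2 * expR ((l - ln l + ln 2 - gamma + 3 * e) / 2) + e * expR ((l - ln l) / 2)).
Proof.
move=> e0 D0; set k := expR (- e) / 2.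
have k2 : k < 2^-1 by rewrite ltr_pdivrMr// mulVf// expR_lt1 oppr_lt0.
near=> l.
have l1 : 1 <= l by near: l; exact: near_pinfty_ge.
have l0 : 0 < l by lra.
have [K0 Kk Z] : let K := Num.truncn (k / ln 2 * l) in
    [/\ (0 < K)%N, (2 ^ K)%:R <= expR (k * l) &
     forall N s, (K <= N)%N -> 0 < s <= D * expR (- (l / 2)) ->
       prime_zeta_sum K N s <= - ln s - ln l + ln 2 - gamma + 3 * e].
  by near: l; exact: near_prime_zeta_upper.
set K := Num.truncn _ in K0 Kk Z.
move=> N0 r X /andP[X0 XN] r0 Xl rD; have r0' : 0 < r%:R :> R by rewrite ltr0n.
(* [2 ^ N0] need not reach the cut [2 ^ K]; enlarging the exponent keeps X <= 2^N. *)
pose N := maxn N0 K.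
have XN' : (0 < X <= 2 ^ N)%N by rewrite X0 (leq_trans XN)// leq_exp2l// leq_maxl.
have KN : (K <= N)%N by exact: leq_maxr.
have sD : 0 < r%:R / expR l <= D * expR (- (l / 2)).
  rewrite divr_gt0 ?expR_gt0//= ler_pdivrMr ?expR_gt0// -mulrA -expRD.
  by have -> : - (l / 2) + l = l / 2 by field.
apply: le_trans (sum_expn_omega_below_le XN' KN r0 (expR_gt0 l) Xl (Z _ _ KN sD)) _.
rewrite ler_pM2l ?expR_gt0// ler_expR ln_div ?posrE ?expR_gt0// expRK addrC.
apply: lerD.
  apply: le_trans (maximum_ineq _ r0'); rewrite ler_pM2l//; clear; lra.
have H1 : ln (r.+1%:R : R) <= l.
  apply: (ln_natS_le_half_expR D0 l1 _ rD).
  by rewrite [l / 2]mulrC; near: l; apply: near_sqr_le_expR; rewrite invr_gt0.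
apply: (@le_trans _ _ (expR (k * l) * l)).
  by apply: ler_pM => //; exact: ln_nat_ge0.
have F : e^-1 * l ^+ 2 <= expR ((2^-1 - k) * l).
  by near: l; apply: near_sqr_le_expR; rewrite subr_gt0.
have -> : (l - ln l) / 2 = (2^-1 - k) * l + k * l - ln l / 2 by field.
rewrite expRB expRD.
have F2 := expR_half_ln_le l1.
have -> : e * (expR ((2^-1 - k) * l) * expR (k * l) / expR (ln l / 2)) =
   expR (k * l) * (e * expR ((2^-1 - k) * l) / expR (ln l / 2)) by ring.
rewrite ler_pM2l ?expR_gt0// ler_pdivlMr ?expR_gt0//.
apply: (@le_trans _ _ (l * l)); first by rewrite ler_pM2l.
by have := ler_wpM2l (ltW e0) F; rewrite mulrA divff ?gt_eqF// mul1r expr2.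
Unshelve. all: by end_near. Qed.

Lemma truncn_expR_bounds (L : R) : 0 <= L ->
  (0 < Num.truncn (expR L))%N /\ ln (Num.truncn (expR L))%:R <= L.
Proof.
move=> L0; have X0 : (0 < Num.truncn (expR L))%N by rewrite truncn_gt0 expR_ge1.
split=> //; rewrite -[leRHS]expRK ler_ln ?posrE ?ltr0n ?expR_gt0//.
by rewrite truncn_le expR_ge0.
Qed.

(** There are at most 3 exp l values of r, since 2^(m-1) <= x. This number fits into one more
    [e * expR ((l - ln l) / 2)], hence [2 * e]. *)
Lemma near_sum_factorizations_le (e : R) : 0 < e ->
  \forall l \near (+oo : set_system R),
    \sum_(1 <= n < (Num.truncn (expR (expR l))).+1) (nb_coprime_factorizations n)%:R <=
    expR (expR l) *
      expR (2 * expR ((l - ln l + ln 2 - gamma + 3 * e) / 2) + 2 * e * expR ((l - ln l) / 2)).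
Proof.
move=> e0; pose D : R := expR (11 - ln (ln 2) / 2).
have D0 : 0 < D by exact: expR_gt0.
have l20 : 0 < ln (2 : R) by have := @ln2_ge_half R; lra.
near=> l.
have l1 : 1 <= l by near: l; exact: near_pinfty_ge.
have l0 : 0 < l by lra.
have L1 : 1 <= expR l by rewrite expR_ge1 ltW.
have small : forall N0 r X, (0 < X <= 2 ^ N0)%N -> (0 < r)%N ->
    ln X%:R <= expR l -> r%:R <= D * expR (l / 2) ->
    sum_expn_omega_below r X / r`!%:R <= expR (expR l) *
      expR (2 * expR ((l - ln l + ln 2 - gamma + 3 * e) / 2) + e * expR ((l - ln l) / 2)).
  by near: l; exact: near_term_le_small.
have [X0 Xl] := truncn_expR_bounds (expR_ge0 l).
set X := Num.truncn _ in X0 Xl *.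
pose m := (trunc_log 2 X).+1.
have Xm : (X < 2 ^ m)%N by exact: trunc_log_ltn.
have mL r : (r < m)%N -> r%:R * ln 2 <= expR l.
  rewrite ltnS => rm; apply: le_trans Xl; rewrite -ln_expn2.
  rewrite ler_ln ?posrE ?ltr0n ?expn_gt0// ler_nat.
  by apply: leq_trans (trunc_logP (isT : (1 < 2)%N) X0); rewrite leq_exp2l.
set B := 2 * expR ((l - ln l + ln 2 - gamma + 3 * e) / 2) + e * expR ((l - ln l) / 2).
have B0 : 0 <= B by rewrite addr_ge0// mulr_ge0 ?expR_ge0// ltW.
apply: le_trans (sum_factorizations_le Xm) _.
apply: (@le_trans _ _ (\sum_(r < m) expR (expR l) * expR B)).
  apply: ler_sum => -[r rm] _ /=.
  have Xm' : (0 < X <= 2 ^ m)%N by rewrite X0 ltnW.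
  have [->|r0] := posnP r.
    apply: (@le_trans _ _ X%:R); last first.
      apply: (@le_trans _ _ (expR (expR l))); first by rewrite truncn_le expR_ge0.
      by rewrite ler_peMr ?expR_ge0// expR_ge1.
    rewrite fact0 divr1 /sum_expn_omega_below.
    apply: (@le_trans _ _ (\sum_(1 <= n < X.+1) 1)).
      by apply: ler_sum => n _; rewrite expr0n; case: eqP.
    by rewrite sumr_const_nat subSS subn0.
  have [rD|rD] := leP r%:R (D * expR (l / 2)); first exact: (small m).
  apply: (@le_trans _ _ (expR (expR l))); last by rewrite ler_peMr ?expR_ge0// expR_ge1.
  by apply: (@term_le_large m) => //; [exact: mL|exact: ltW].
rewrite sumr_const card_ord -mulrnAr ler_pM2l ?expR_gt0// -mulr_natl.
have -> : 2 * expR ((l - ln l + ln 2 - gamma + 3 * e) / 2) + 2 * e * expR ((l - ln l) / 2) =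
   e * expR ((l - ln l) / 2) + B by rewrite /B; ring.
rewrite [expR (e * _ + B)]expRD ler_pM2r ?expR_gt0//.
have m3 : m%:R <= 3 * expR l.
  rewrite /m -natr1; have := mL _ (ltnSn (trunc_log 2 X)); have := @ln2_ge_half R => H.
  have : (trunc_log 2 X)%:R * 2^-1 <= (trunc_log 2 X)%:R * ln 2 :> R by rewrite ler_wpM2l.
  lra.
apply: le_trans m3 _.
have F : (2 + 1) / e * l ^+ 2 <= expR (2^-1 * l) by near: l; apply: near_sqr_le_expR; lra.
have E3 : 3 <= expR 2 :> R by have := expR_ge1Dx (2 : R); lra.
apply: (@le_trans _ _ (expR (2 + l))); first by rewrite expRD ler_pM2r ?expR_gt0.
rewrite ler_expR.
have -> : (l - ln l) / 2 = 2^-1 * l - ln l / 2 by field.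
have F2 := expR_half_ln_le l1.
rewrite expRB mulrA ler_pdivlMr ?expR_gt0//.
apply: (@le_trans _ _ ((2 + l) * l)); first by rewrite ler_pM2l//; lra.
have := ler_wpM2l (ltW e0) F.
have -> : e * ((2 + 1) / e * l ^+ 2) = 3 * l ^+ 2 by field; rewrite gt_eqF.
apply: le_trans; rewrite expr2 mulrA ler_pM2r//; lra.
Unshelve. all: by end_near. Qed.

End UpperBound.

(** * Lower bound *)

Section LowerBound.
Context {R : realType}.
Local Notation gamma := (euler_gamma R).

(** The maximizing m: its square is 2 e^(-gamma) log x / log log x for l = log log x. *)
Definition saddle (l : R) : R := expR ((l - ln l + ln 2 - gamma) / 2).

Lemma saddle_bounds (l : R) : 1 <= l ->
  expR ((ln 2 - gamma) / 2) * expR (l / 2) / l <= saddle l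
  <= expR ((ln 2 - gamma) / 2) * expR (l / 2).
Proof.
move=> l1; have l0 : 0 < l by lra.
have ll0 := ln_ge0 l1.
rewrite -expRD -[X in _ / X](lnK (x := l)) ?posrE// -expRB !ler_expR.
by apply/andP; split; lra.
Qed.

Lemma near_saddle_ge (C : R) : \forall l \near (+oo : set_system R), C * l <= saddle l.
Proof.
have D0 : 0 < expR ((ln 2 - gamma) / 2) by exact: expR_gt0.
near=> l.
have l1 : 1 <= l by near: l; exact: near_pinfty_ge.
have l0 : 0 < l by lra.
have /andP[H _] := saddle_bounds l1; apply: le_trans H.
rewrite ler_pdivlMr// -mulrA -expr2 mulrC -ler_pdivrMl//.
have -> : l / 2 = 2^-1 * l by field.
have F : (expR ((ln 2 - gamma) / 2))^-1 * C * l ^+ 2 <= expR (2^-1 * l).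
  by near: l; apply: near_sqr_le_expR; lra.
by apply: le_trans F; rewrite mulrC mulrA.
Unshelve. all: by end_near. Qed.

(** [V] is 2 log mu - log j, hence close to log j. The multiplier [u] is free so that three
    neighbouring tilts can be compared, in which [V] cancels. *)
Lemma near_ln_euler_prod (e u : R) : 0 < e -> 0 < u ->
  \forall l \near (+oo : set_system R),
    let j := Num.truncn (saddle l) in
    let V := l - ln j%:R - ln l + ln 2 - gamma in
    exists N0, forall N, (N0 <= N)%N ->
      j%:R * (V - ln u - 5 * e) <=
        ln (euler_prod j (2 ^ N).+1 (u * j%:R / expR l)) <= j%:R * (V - ln u + 4 * e).
Proof.
move=> e0 u0; set D0 : R := expR ((ln 2 - gamma) / 2).
have D00 : 0 < D0 by exact: expR_gt0.
have D1 : 0 < u * D0 by exact: mulr_gt0.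
have k2 : expR (- e) / 2 < 2^-1.
  by rewrite ltr_pdivrMr// mulVf// expR_lt1 oppr_lt0.
have k2' : 2^-1 < expR e / 2.
  by rewrite ltr_pdivlMr// mulVf// expR_gt1.
near=> l.
have l1 : 1 <= l by near: l; exact: near_pinfty_ge.
have l0 : 0 < l by lra.
have Z1 : let K := Num.truncn (expR (- e) / 2 / ln 2 * l) in
    [/\ (0 < K)%N, (2 ^ K)%:R <= expR (expR (- e) / 2 * l) &
     forall N s, (K <= N)%N -> 0 < s <= (u * D0) * expR (- (l / 2)) ->
       prime_zeta_sum K N s <= - ln s - ln l + ln 2 - gamma + 3 * e].
  by near: l; exact: near_prime_zeta_upper.
have Z2 : let K := (Num.truncn (expR e / 2 / ln 2 * l)).+1 in
    expR (expR e / 2 * l) <= (2 ^ K)%:R /\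
    forall s, 0 < s -> exists N0, forall N, (N0 <= N)%N -> (K <= N)%N /\
      - ln s - ln l + ln 2 - gamma - 4 * e <= prime_zeta_sum K N s.
  by near: l; exact: near_prime_zeta_lower.
have M1 : 1 * l <= saddle l by near: l; exact: near_saddle_ge.
have /andP[muL muU] := saddle_bounds l1; rewrite -/D0 in muL muU.
have F1 : D0^-1 * 2 * e^-1 * l ^+ 2 <= expR ((2^-1 - expR (- e) / 2) / 2 * l).
  by near: l; apply: near_sqr_le_expR; lra.
have F2 : D0 / e * l ^+ 2 <= expR ((expR e / 2 - 2^-1) * l).
  by near: l; apply: near_sqr_le_expR; lra.
have F3 : (D0 + 1) * l ^+ 2 <= expR (2^-1 * l) by near: l; apply: near_sqr_le_expR; lra.
have F4 : 1 * l ^+ 2 <= expR ((2^-1 - expR (- e) / 2) / 2 * l).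
  by near: l; apply: near_sqr_le_expR; lra.
set j := Num.truncn _; set V := l - ln j%:R - ln l + ln 2 - gamma.
set K1 := Num.truncn _ in Z1; set K2 := _.+1 in Z2.
have mu0 : 0 < saddle l by exact: expR_gt0.
have j0 : (0 < j)%N by rewrite truncn_gt0; apply: le_trans M1; rewrite mul1r.
have j0' : 0 < j%:R :> R by rewrite ltr0n.
have jmu : j%:R <= saddle l by rewrite truncn_le ltW.
have muj : saddle l <= 2 * j%:R.
  have := truncnS_gt (saddle l); rewrite -/j -natr1.
  have : 1 <= j%:R :> R by rewrite ler1n.
  by clear; lra.
have l2 : 1 <= l ^+ 2 by rewrite expr2 mulr_ege1.
have lnj : ln (j.+1%:R : R) <= l.
  apply: (ln_natS_le_half_expR D00 l1 _ (le_trans jmu muU)).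
  by rewrite [l / 2]mulrC.
set s := u * j%:R / expR l.
have s0 : 0 < s by rewrite divr_gt0 ?expR_gt0// mulr_gt0.
have lns : ln s = ln u + ln j%:R - l.
  by rewrite ln_div ?posrE ?expR_gt0 ?mulr_gt0// lnM ?posrE// expRK.
have [K1_0 K1k Z1'] := Z1; have [K2k Z2'] := Z2.
have [N0 Z2s] := Z2' s s0.
exists (maxn N0 K1) => N; rewrite geq_max => /andP[NN0 K1N].
have [K2N Z2N] := Z2s N NN0.
apply/andP; split.
  apply: le_trans (ln_euler_prod_ge j K2N (ltW s0)).
  have H1 : j%:R ^+ 2 / (2 ^ K2)%:R <= e * j%:R.
    rewrite ler_pdivrMr ?ltr0n ?expn_gt0// expr2 [e * _]mulrC -mulrA ler_pM2l//.
    rewrite mulrC; apply: (@le_trans _ _ (expR (expR e / 2 * l) * e)); last by rewrite ler_pM2r.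
    rewrite -ler_pdivrMr//; apply: (@le_trans _ _ (D0 / e * expR (l / 2))).
      have -> : D0 / e * expR (l / 2) = D0 * expR (l / 2) / e by ring.
      by rewrite ler_pM2r ?invr_gt0// (le_trans jmu).
    have -> : expR e / 2 * l = (expR e / 2 - 2^-1) * l + l / 2 by field.
    rewrite expRD ler_pM2r ?expR_gt0//; apply: le_trans F2.
    by rewrite ler_peMr// divr_ge0// ltW.
  have := ler_wpM2l (ltW j0') Z2N; rewrite lns /V; move: H1; clear; lra.
apply: le_trans (ln_euler_prod_le j K1N (ltW s0)) _.
have sD : 0 < s <= u * D0 * expR (- (l / 2)).
  rewrite s0 /= /s ler_pdivrMr ?expR_gt0// -!mulrA ler_pM2l// -expRD.
  have -> : - (l / 2) + l = l / 2 by field.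
  exact: le_trans jmu muU.
have := ler_wpM2l (ltW j0') (Z1' N s K1N sD); rewrite lns.
have H1 : (2 ^ K1)%:R * ln j.+1%:R <= e * j%:R.
  apply: (@le_trans _ _ (expR (expR (- e) / 2 * l) * l)).
    by apply: ler_pM => //; exact: ln_nat_ge0.
  apply: (@le_trans _ _ (e * (saddle l / 2))); last first.
    by rewrite ler_pM2l// ler_pdivrMr// mulrC.
  apply: (@le_trans _ _ (e * (D0 * expR (l / 2) / l / 2))); last first.
    by rewrite ler_pM2l// ler_pM2r.
  have -> : e * (D0 * expR (l / 2) / l / 2) = (D0 * e / 2 * expR (l / 2)) / l.
    by field; rewrite gt_eqF.
  rewrite ler_pdivlMr// -[_ * l * l]mulrA -expr2.
  (* The gap between k and 1/2 is split in two halves: one pays for the factor l^2, the other for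
     the constants. *)
  have -> : l / 2 = expR (- e) / 2 * l + (2^-1 - expR (- e) / 2) / 2 * l
     + (2^-1 - expR (- e) / 2) / 2 * l by field.
  set a := (2^-1 - expR (- e) / 2) / 2 * l in F1 F4 *; rewrite !expRD.
  have -> : D0 * e / 2 * (expR (expR (- e) / 2 * l) * expR a * expR a) =
    expR (expR (- e) / 2 * l) * (D0 * e / 2 * expR a * expR a) by ring.
  rewrite ler_pM2l ?expR_gt0//.
  apply: (@le_trans _ _ (1 * expR a)); first by move: F4; rewrite !mul1r.
  rewrite ler_pM2r ?expR_gt0// -ler_pdivrMl ?mulr_gt0 ?divr_gt0//.
  apply: le_trans F1; have -> : (D0 * e / 2)^-1 * 1 = D0^-1 * 2 * e^-1.
    by field; rewrite !gt_eqF.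
  by rewrite ler_peMr// !mulr_ge0 ?invr_ge0 ?ltW.
by rewrite /V; move: H1; clear; lra.
Unshelve. all: by end_near. Qed.

End LowerBound.

Section Main.
Context {R : realType}.
Local Notation gamma := (euler_gamma R).

Lemma sum_factorizations_ge j X (T : R) N : (0 < X <= 2 ^ N)%N ->
  T <= \sum_(A : {set 'I_(2 ^ N).+1} |
         (A \subset prime_set (2 ^ N).+1) && (@log_prod R _ A <= ln X%:R)) weight j A ->
  X%:R / 2 * T / j.+1`!%:R <=
  \sum_(1 <= n < X.+1) (nb_coprime_factorizations n)%:R.
Proof.
move=> /andP[X0 XN] HT; rewrite ler_pdivrMr ?ltr0n ?fact_gt0//.
have XN' : (0 < X < (2 ^ N).+1)%N by rewrite X0.
apply: (@le_trans _ _ (\sum_(1 <= n < X.+1) (j.+1%:R : R) ^+ size (primes n))).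
  by apply: le_trans (sum_expn_omega_ge j XN'); rewrite ler_wpM2l// divr_ge0.
rewrite mulr_suml; apply: ler_sum_nat => n /andP[n0 _].
by rewrite -natrX -natrM ler_nat mulnC expn_le_nb_factorizations.
Qed.

(** * The tails of the tilted sum *)

Lemma expR_mul_le_quarter (x y z : R) : 0 < y -> 0 < z -> x + ln y + 3 <= ln z ->
  expR x * y <= z / 4.
Proof.
move=> y0 z0 H; have -> : y = expR (ln y) by rewrite lnK.
have -> : z = expR (ln z) by rewrite lnK.
rewrite -expRD ler_pdivlMr//.
apply: (@le_trans _ _ (expR (x + ln y) * expR 3)); last by rewrite -expRD ler_expR.
by rewrite ler_pM2l ?expR_gt0//; have := expR_ge1Dx (3 : R); lra.
Qed.

(** Controls the tail log d > log x, tested with the smaller tilt 1 + h/2: the gain h^2/6 is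
    positive because the tilted mean L / (1 + h) lies below L. *)
Lemma ln_tilt_below (h : R) : 0 < h <= 4^-1 ->
  ln (1 + h) - ln (1 + h / 2) <= h / 2 - h ^+ 2 / 6.
Proof.
move=> /andP[h0 h4]; have u0 : 0 < 1 + h by lra.
have u1 : 0 < 1 + h / 2 by lra.
rewrite -ln_div ?posrE//; apply: le_trans (ln_le_sub1 _) _; first exact: divr_gt0.
have -> : (1 + h) / (1 + h / 2) - 1 = h / 2 / (1 + h / 2).
  by field; rewrite gt_eqF//; lra.
rewrite ler_pdivrMr// -subr_ge0.
have -> : (h / 2 - h ^+ 2 / 6) * (1 + h / 2) - h / 2 = h ^+ 2 * ((1 - h) / 12) by field.
by rewrite mulr_ge0 ?exprn_ge0 ?divr_ge0//; lra.
Qed.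

(** The tail log d <= (1 - 2h) L, tested with the larger tilt 1 + 3h/2; the gain h^2/4 reflects (1 -
    2h) L < L / (1 + h). *)
Lemma ln_tilt_above (h : R) : 0 < h <= 4^-1 ->
  h / 2 * (1 - 2 * h) + h ^+ 2 / 4 <= ln (1 + 3 * h / 2) - ln (1 + h).
Proof.
move=> /andP[h0 h4]; have u0 : 0 < 1 + h by lra.
have u2 : 0 < 1 + 3 * h / 2 by lra.
rewrite -ln_div ?posrE//; apply: le_trans (ln_ge_1subV _); last exact: divr_gt0.
rewrite invf_div.
have -> : 1 - (1 + h) / (1 + 3 * h / 2) = h / 2 / (1 + 3 * h / 2).
  by field; rewrite gt_eqF//; lra.
rewrite ler_pdivlMr// -subr_ge0.
have -> : h / 2 - (h / 2 * (1 - 2 * h) + h ^+ 2 / 4) * (1 + 3 * h / 2) = h ^+ 3 * (9 / 8).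
  by field.
by rewrite mulr_ge0 ?exprn_ge0//; lra.
Qed.

(** The errors add up to 10 e = h^2/12, half of the gain h^2/6; what remains is j h^2/12 >= 3 > log
    4. *)
Lemma tilt_below_exponent (j h e V A B g0 g1 q : R) : e = h ^+ 2 / 120 ->
  0 < j -> 3 <= j * (h ^+ 2 / 12) -> A - B <= h / 2 - h ^+ 2 / 6 ->
  h / 2 * j - e * j <= q -> j * (V - A - 5 * e) <= g0 -> g1 <= j * (V - B + 4 * e) ->
  - q + g1 + 3 <= g0.
Proof.
move=> -> j0 jh /(ler_wpM2l (ltW j0)) AB Q G0 G1.
lra.
Qed.

Lemma tilt_above_exponent (j h e V A B g0 g2 : R) : e = h ^+ 2 / 120 ->
  0 < j -> 3 <= j * (h ^+ 2 / 12) ->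
  h / 2 * (1 - 2 * h) + h ^+ 2 / 4 <= B - A ->
  j * (V - A - 5 * e) <= g0 -> g2 <= j * (V - B + 4 * e) ->
  (1 - 2 * h) * (h / 2 * j) + g2 + 3 <= g0.
Proof.
move=> -> j0 jh /(ler_wpM2l (ltW j0)) AB G0 G2.
lra.
Qed.

Lemma tilted_weight_ge j M X (h e L V : R) : 0 < h <= 4^-1 -> e = h ^+ 2 / 120 ->
  0 < L -> 1 <= e * L -> L - 1 <= ln X%:R -> 3 <= j%:R * (h ^+ 2 / 12) ->
  j%:R * (V - ln (1 + h) - 5 * e) <= ln (euler_prod j M ((1 + h) * j%:R / L)) ->
  ln (euler_prod j M ((1 + h / 2) * j%:R / L)) <= j%:R * (V - ln (1 + h / 2) + 4 * e) ->
  ln (euler_prod j M ((1 + 3 * h / 2) * j%:R / L)) <=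
    j%:R * (V - ln (1 + 3 * h / 2) + 4 * e) ->
  expR ((1 + h) * (1 - 2 * h) * j%:R + ln (euler_prod j M ((1 + h) * j%:R / L))) / 2 <=
    \sum_(A : {set 'I_M} | (A \subset prime_set M) && (@log_prod R _ A <= ln X%:R))
      weight j A.
Proof.
move=> h4 eE L0 eL XL jh; have h0 : 0 < h by case/andP: h4.
have j0 : 0 <= j%:R :> R by [].
have j0' : 0 < j%:R :> R.
  by rewrite lt_neqAle j0 andbT; apply: contraTneq jh => <-; rewrite mul0r -ltNge.
set s := (1 + h) * j%:R / L; pose t := h / 2 * j%:R / L.
have L0' : L != 0 by rewrite gt_eqF.
have -> : (1 + h / 2) * j%:R / L = s - t by rewrite /s /t; field.
have -> : (1 + 3 * h / 2) * j%:R / L = s + t by rewrite /s /t; field.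
move=> G0 G1 G2.
have t0 : 0 < t by rewrite divr_gt0// mulr_gt0// divr_gt0.
have s0 : 0 <= s by rewrite divr_ge0 ?(ltW L0)// mulr_ge0// addr_ge0// ltW.
have sL : s * L = (1 + h) * j%:R by rewrite /s divfK.
have tL : t * L = h / 2 * j%:R by rewrite /t divfK.
have win := @tilted_window_le R {set 'I_M} (fun A => A \subset prime_set M)
  (@weight R j M) (@log_prod R M) s t (ln X%:R) ((1 - 2 * h) * L) s0 (ltW t0)
  (fun (A : {set 'I_M}) _ => weight_ge0 j A).
rewrite -!euler_prodE in win; apply: le_trans win.
have T1 : expR (- t * ln X%:R) * euler_prod j M (s - t) <= euler_prod j M s / 4.
  apply: expR_mul_le_quarter; rewrite ?euler_prod_gt0// mulNr.
  apply: (tilt_below_exponent eE j0' jh (ln_tilt_below h4) _ G0 G1).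
  (* The window ends at log X, which may fall short of L by 1; this costs at most t in the
     exponent. *)
  have te : t <= e * j%:R.
    rewrite /t ler_pdivrMr// [e * _ * _]mulrAC (ler_pM2r j0'); apply: le_trans _ eL.
    by case/andP: h4 => _ h4; clear -h0 h4; lra.
  apply: le_trans (ler_wpM2l (ltW t0) XL); rewrite mulrBr tL mulr1.
  by rewrite lerD2l lerN2.
have T2 : expR (t * ((1 - 2 * h) * L)) * euler_prod j M (s + t) <= euler_prod j M s / 4.
  apply: expR_mul_le_quarter; rewrite ?euler_prod_gt0// mulrCA tL.
  exact: (tilt_above_exponent eE j0' jh (ln_tilt_above h4) G0 G2).
have -> : (1 + h) * (1 - 2 * h) * j%:R = s * ((1 - 2 * h) * L) by rewrite mulrCA sL; ring.
rewrite expRD lnK ?posrE ?euler_prod_gt0// -mulrA ler_pM2l ?expR_gt0//.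
move: T1 T2; clear; lra.
Qed.

(** About j comes from the tilt, j log j from the Euler product and -(j log j - j) from the
    factorial, in total 2j up to O(h j). The 3 pays for three factors 2: the floor of x, the floor
    of X/d, and the two tails. *)
Lemma saddle_exponent (j h mu V g : R) (n : nat) : 0 < h <= 4^-1 -> j = n%:R -> (0 < n)%N ->
  mu <= j + 1 -> 8 <= h * j -> 2 * ln n.+1%:R + 4 <= h * j ->
  ln j <= V -> j * (V - ln (1 + h) - 5 * (h ^+ 2 / 120)) <= g ->
  (2 - 8 * h) * mu + ln n.+1`!%:R + 3 <= (1 + h) * (1 - 2 * h) * j + g.
Proof.
move=> /andP[h0 h4] jE n0 muj hj8 lnj jV G.
have j0 : 0 < j by rewrite jE ltr0n.
have F1 := @ln_fact_le_sharp R n n0; have F2 := ln_factS (R := R) n.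
have F3 : ln (n%:R : R) <= ln n.+1%:R by rewrite ler_ln ?posrE ?ltr0n// ler_nat.
have F4 : ln (1 + h) <= h by rewrite le_ln1Dx//; lra.
have F5 : (2 - 8 * h) * mu <= (2 - 8 * h) * (j + 1) by rewrite ler_wpM2l//; lra.
have h2h : h ^+ 2 <= h / 4 by rewrite expr2 ler_pM2l.
have F7 : j * (ln j - h - h / 96) <= g.
  by apply: le_trans G; rewrite ler_pM2l//; lra.
have F8 : (1 - 3 / 2 * h) * j <= (1 + h) * (1 - 2 * h) * j.
  rewrite ler_pM2r// -subr_ge0.
  have -> : (1 + h) * (1 - 2 * h) - (1 - 3 / 2 * h) = h / 2 - 2 * h ^+ 2 by field.
  by move: h2h; clear; lra.
rewrite -jE in F1 F3; rewrite F2.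
move: F1 F3 F5 F7 F8 lnj hj8 h0; clear; lra.
Qed.

Lemma near_sum_factorizations_ge (h : R) : 0 < h <= 4^-1 ->
  \forall l \near (+oo : set_system R),
    expR (expR l) * expR ((2 - 8 * h) * saddle l) <=
    \sum_(1 <= n < (Num.truncn (expR (expR l))).+1) (nb_coprime_factorizations n)%:R.
Proof.
move=> h4; have h0 : 0 < h by case/andP: h4.
set e := h ^+ 2 / 120.
have h20 : 0 < h ^+ 2 by rewrite exprn_gt0.
have e0 : 0 < e by rewrite divr_gt0.
have u0 : 0 < 1 + h by lra.
have u1 : 0 < 1 + h / 2 by lra.
have u2 : 0 < 1 + 3 * h / 2 by lra.
near=> l.
have l1 : 1 <= l by near: l; exact: near_pinfty_ge.
have l0 : 0 < l by exact: lt_le_trans l1.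
have le : e^-1 <= l by near: l; exact: near_pinfty_ge.
have lg : 2 - gamma <= l by near: l; exact: near_pinfty_ge.
have l2 : 2 <= l by near: l; exact: near_pinfty_ge.
have G0 : let j := Num.truncn (saddle l) in
    let V := l - ln j%:R - ln l + ln 2 - gamma in
    exists N0, forall N, (N0 <= N)%N ->
      j%:R * (V - ln (1 + h) - 5 * e) <=
        ln (euler_prod j (2 ^ N).+1 ((1 + h) * j%:R / expR l)) <=
      j%:R * (V - ln (1 + h) + 4 * e).
  by near: l; exact: near_ln_euler_prod.
have G1 : let j := Num.truncn (saddle l) in
    let V := l - ln j%:R - ln l + ln 2 - gamma in
    exists N0, forall N, (N0 <= N)%N ->
      j%:R * (V - ln (1 + h / 2) - 5 * e) <=
        ln (euler_prod j (2 ^ N).+1 ((1 + h / 2) * j%:R / expR l)) <=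
      j%:R * (V - ln (1 + h / 2) + 4 * e).
  by near: l; exact: near_ln_euler_prod.
have G2 : let j := Num.truncn (saddle l) in
    let V := l - ln j%:R - ln l + ln 2 - gamma in
    exists N0, forall N, (N0 <= N)%N ->
      j%:R * (V - ln (1 + 3 * h / 2) - 5 * e) <=
        ln (euler_prod j (2 ^ N).+1 ((1 + 3 * h / 2) * j%:R / expR l)) <=
      j%:R * (V - ln (1 + 3 * h / 2) + 4 * e).
  by near: l; exact: near_ln_euler_prod.
(* The added 1 makes up for truncating mu to the integer j; 36/h^2 yields j h^2/12 >= 3, and 8/h
   yields h j >= 8 l. *)
have S1 : (36 / h ^+ 2 + 1) * l <= saddle l by near: l; exact: near_saddle_ge.
have S2 : (8 / h + 1) * l <= saddle l by near: l; exact: near_saddle_ge.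
set mu := saddle l in S1 S2 G0 G1 G2 *.
set j := Num.truncn mu in G0 G1 G2.
have mu0 : 0 < mu by exact: expR_gt0.
have muj : mu <= j%:R + 1 by rewrite natr1 ltW// truncnS_gt.
have jmu : j%:R <= mu by rewrite truncn_le ltW.
have below (C : R) : 0 < C -> (C + 1) * l <= mu -> C * l <= j%:R.
  by move=> C0; rewrite mulrDl; move: muj l1; clear; lra.
have j8 : 8 * l <= h * j%:R.
  have := below _ (divr_gt0 (ltr0n _ 8) h0) S2.
  by move=> /(ler_wpM2l (ltW h0)); rewrite mulrA mulrCA divff ?gt_eqF// mulr1.
have j36 : 3 <= j%:R * (h ^+ 2 / 12).
  have H : 36 / h ^+ 2 <= j%:R.
    apply: le_trans (below _ (divr_gt0 (ltr0n _ 36) h20) S1).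
    by rewrite ler_peMr// divr_ge0// ltW.
  by move: H; rewrite ler_pdivrMr//; clear; lra.
have j8' : 8 <= h * j%:R by move: j8 l1; clear; lra.
have j0 : (0 < j)%N.
  by rewrite lt0n; apply: contraTneq j8' => ->; rewrite mulr0 -ltNge.
have j0' : 0 < j%:R :> R by rewrite ltr0n.
have lnmu : 2 * ln mu = l - ln l + ln 2 - gamma by rewrite /mu /saddle expRK; field.
have lnjmu : ln (j%:R : R) <= ln mu by rewrite ler_ln ?posrE.
have lnj1 : 2 * ln (j.+1%:R : R) + 4 <= h * j%:R.
  have A1 : ln (j.+1%:R : R) <= ln 2 + ln mu.
    rewrite -lnM ?posrE// ler_ln ?posrE ?ltr0n ?mulr_gt0// -natr1.
    have : 1 <= j%:R :> R by rewrite ler1n.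
    by move: jmu; clear; lra.
  have := @ln2_le1 R; have := ln_ge0 l1; move: A1 j8 lg l2 lnmu; clear; lra.
have [X0 Xl] := truncn_expR_bounds (expR_ge0 l).
set X := Num.truncn (expR _) in X0 Xl *.
have X2 : expR (expR l) <= 2 * X%:R.
  have := truncnS_gt (expR (expR l)); rewrite -/X -natr1.
  have : 1 <= X%:R :> R by rewrite ler1n.
  clear; lra.
have Xl' : expR l - 1 <= ln X%:R.
  have : expR l <= ln (2 * X%:R : R).
    by rewrite -[leLHS]expRK ler_ln ?posrE ?expR_gt0 ?mulr_gt0 ?ltr0n.
  rewrite lnM ?posrE ?ltr0n//; have := @ln2_le1 R; clear; lra.
have [N0 {}G0] := G0; have [N1 {}G1] := G1; have [N2 {}G2] := G2.
pose N := maxn (maxn N0 N1) (maxn N2 (trunc_log 2 X).+1).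
have XN : (0 < X <= 2 ^ N)%N.
  rewrite X0 (leq_trans (ltnW (trunc_log_ltn X (isT : (1 < 2)%N))))// leq_exp2l//.
  by rewrite /N !leq_max leqnn !orbT.
have /G0/andP[G0l _] : (N0 <= N)%N by rewrite /N !leq_max leqnn.
have /G1/andP[_ G1u] : (N1 <= N)%N by rewrite /N !leq_max leqnn !orbT.
have /G2/andP[_ G2u] : (N2 <= N)%N by rewrite /N !leq_max leqnn !orbT.
have E1 : 1 <= e * expR l.
  rewrite mulrC -ler_pdivrMr// div1r (le_trans le)//.
  by have := expR_ge1Dx l; clear; lra.
have W := tilted_weight_ge h4 erefl (expR_gt0 l) E1 Xl' j36 G0l G1u G2u.
apply: le_trans (sum_factorizations_ge XN W).
have lnV : ln j%:R <= l - ln j%:R - ln l + ln 2 - gamma.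
  by move: lnmu lnjmu; clear; lra.
have f0 : 0 < j.+1`!%:R :> R by rewrite ltr0n fact_gt0.
have key := saddle_exponent h4 erefl j0 muj j8' lnj1 lnV G0l.
rewrite -ler_expR [leLHS]expRD [expR (_ + ln _)]expRD lnK ?posrE// in key.
rewrite (ler_pdivlMr _ _ f0).
have E8 : 8 <= expR 3 :> R.
  have -> : 3 = 3%:R * 1 :> R by rewrite mulr1.
  have a2 : 2 <= expR 1 :> R by have := expR_ge1Dx (1 : R).
  rewrite expRM_natl; have : 2 ^+ 3 <= expR 1 ^+ 3 :> R by rewrite lerXn2r ?nnegrE ?expR_ge0.
  by rewrite !exprS expr0; clear; lra.
set a := expR ((2 - 8 * h) * mu) in key *; set b := j.+1`!%:R in f0 key *.
set c := expR (_ + ln _) in key *.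
have ab0 : 0 < a * b by rewrite mulr_gt0 ?expR_gt0.
have c8 : 8 * (a * b) <= c by apply: le_trans key; rewrite mulrC ler_pM2l.
rewrite -[_ * a * b]mulrA; apply: (@le_trans _ _ (2 * X%:R * (a * b))).
  by rewrite (ler_pM2r ab0).
have : X%:R / 4 * (8 * (a * b)) <= X%:R / 4 * c by rewrite ler_wpM2l// divr_ge0.
move: (a * b) => ab; clear; lra.
Unshelve. all: by end_near. Qed.

End Main.

(** * Conclusion *)

Section Final.
Context {R : realType}.
Local Notation gamma := (euler_gamma R).

Lemma near_ln_ln (P : R -> Prop) : (\forall l \near (+oo : set_system R), P l) ->
  \forall x \near (+oo : set_system R), P (ln (ln x)).
Proof.
move=> [M [_ MP]]; exists (expR (expR M)); split; first exact: num_real.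
move=> x Mx; apply: MP.
have x0 : 0 < x by apply: lt_trans Mx; exact: expR_gt0.
have L : expR M < ln x by rewrite -ltr_expR lnK.
by rewrite -ltr_expR lnK// posrE (lt_trans _ L)// expR_gt0.
Qed.

Lemma expR_le1D2x (x : R) : 0 <= x <= 2^-1 -> expR x <= 1 + 2 * x.
Proof.
move=> /andP[x0 x2]; have := expR_ge1Dx (- x); rewrite expRN => H.
have E := expR_gt0 x; have x1 : 0 < 1 - x by lra.
apply: (@le_trans _ _ (1 - x)^-1).
  by rewrite -[leLHS]invrK lef_pV2 ?posrE ?invr_gt0.
rewrite -div1r ler_pdivrMr//; nra.
Qed.

Lemma sqrt_expR (x : R) : Num.sqrt (expR x) = expR (x / 2).
Proof. by rewrite [x in LHS]splitr expRD -expr2 sqrtr_sqr gtr0_norm ?expR_gt0. Qed.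

Lemma saddle_constE : 2 * Num.sqrt 2 * expR (- gamma / 2) = 2 * expR ((ln 2 - gamma) / 2).
Proof.
have -> : Num.sqrt (2 : R) = expR (ln 2 / 2) by rewrite -sqrt_expR lnK ?posrE.
by rewrite -mulrA -expRD mulrBl mulNr.
Qed.

Lemma near_sum_factorizations_bounds (c e : R) : c = 2 * expR ((ln 2 - gamma) / 2) ->
  0 < e -> \forall x \near (+oo : set_system R),
    let Y := Num.sqrt (ln x / ln (ln x)) in
    [/\ 0 < x, 0 < Y & x * expR ((c - e) * Y) <=
      \sum_(1 <= n < (Num.truncn x).+1) (nb_coprime_factorizations n)%:R
        <= x * expR ((c + e) * Y)].
Proof.
move=> cE e0; have c0 : 0 < c by rewrite cE mulr_gt0 ?expR_gt0.
(* Chosen so that c (1 + 3 e1) + 2 e1 <= c + e and 4 h c <= e; the extra multiples of [e] in the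
   denominators force e1 <= 1/3 and h <= 1/4. *)
pose e1 := e / (3 * c + 2 + 3 * e); pose h := e / (4 * c + 4 * e).
have d0 : 0 < 3 * c + 2 + 3 * e by lra.
have d1 : 0 < 4 * c + 4 * e by lra.
have e1_0 : 0 < e1 by rewrite divr_gt0.
have h0 : 0 < h by rewrite divr_gt0.
have e1E : e1 * (3 * c + 2 + 3 * e) = e by rewrite divfK// gt_eqF.
have hE : h * (4 * c + 4 * e) = e by rewrite divfK// gt_eqF.
have e13 : e1 <= 3^-1 by rewrite ler_pdivrMr//; lra.
have h4 : 0 < h <= 4^-1 by rewrite h0 ler_pdivrMr//; lra.
have up := near_ln_ln (near_sum_factorizations_le e1_0).
have lo := near_ln_ln (near_sum_factorizations_ge h4).
near=> x => /=.
have x0 : 0 < x by near: x; exact: nbhs_pinfty_gt.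
have L1 : 1 < ln x.
  rewrite -ltr_expR (lnK x0).
  by near: x; exact: nbhs_pinfty_gt.
have L0 : 0 < ln x by exact: lt_trans L1.
have l0 : 0 < ln (ln x) by rewrite ln_gt0.
have xE : expR (expR (ln (ln x))) = x by rewrite !lnK ?posrE.
have YE : Num.sqrt (ln x / ln (ln x)) = expR ((ln (ln x) - ln (ln (ln x))) / 2).
  by rewrite -sqrt_expR expRB !lnK ?posrE.
have lox : x * expR ((2 - 8 * h) * saddle (ln (ln x))) <=
    \sum_(1 <= n < (Num.truncn x).+1) (nb_coprime_factorizations n)%:R.
  by rewrite -[in X in _ <= X]xE -[X in X * _]xE; near: x.
have upx : \sum_(1 <= n < (Num.truncn x).+1) (nb_coprime_factorizations n)%:R <=
    x * expR (2 * expR ((ln (ln x) - ln (ln (ln x)) + ln 2 - gamma + 3 * e1) / 2) +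
      2 * e1 * expR ((ln (ln x) - ln (ln (ln x))) / 2)).
  by rewrite -[in X in X <= _]xE -[X in _ <= X * _]xE; near: x.
rewrite YE; set Y := expR ((ln (ln x) - ln (ln (ln x))) / 2) in upx *.
have Y0 : 0 < Y by exact: expR_gt0.
split; [exact: x0|exact: Y0|apply/andP; split].
  apply: le_trans lox; rewrite ler_pM2l// ler_expR.
  have -> : saddle (ln (ln x)) = c / 2 * Y.
    by rewrite /saddle cE [2 * _]mulrC mulfK// /Y -expRD; congr expR; field.
  have : 4 * (h * c) * Y <= e * Y by rewrite ler_pM2r// -hE; nra.
  lra.
apply: (le_trans upx); rewrite ler_pM2l// ler_expR.
have -> : expR ((ln (ln x) - ln (ln (ln x)) + ln 2 - gamma + 3 * e1) / 2) =
   c / 2 * expR (3 * e1 / 2) * Y.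
  by rewrite cE [2 * _]mulrC mulfK// /Y -!expRD; congr expR; field.
have E : expR (3 * e1 / 2) <= 1 + 2 * (3 * e1 / 2) by apply: expR_le1D2x; lra.
have : (c * expR (3 * e1 / 2) + 2 * e1) * Y <= (c + e) * Y.
  rewrite ler_pM2r//; have := ler_wpM2l (ltW c0) E; have := mulr_gt0 e1_0 e0; lra.
lra.
Unshelve. all: by end_near. Qed.

End Final.

Theorem theorem1p1 (R : realType) :
  let c : R := 2 * Num.sqrt 2 * expR (- euler_gamma R / 2) in
  exists eps : R -> R,
    (eps x @[x --> +oo] --> (0 : R)) /\
    (\forall x \near (+oo : set_system R),
      \sum_(1 <= n < (Num.truncn x).+1) (nb_coprime_factorizations n)%:R =
        x * expR ((c + eps x) * Num.sqrt (ln x / ln (ln x)))).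
Proof.
move=> c; pose S (x : R) : R :=
  \sum_(1 <= n < (Num.truncn x).+1) (nb_coprime_factorizations n)%:R.
pose Y (x : R) := Num.sqrt (ln x / ln (ln x)).
have cE : c = 2 * expR ((ln 2 - euler_gamma R) / 2) := saddle_constE.
have bounds e : 0 < e -> \forall x \near (+oo : set_system R), [/\ 0 < x, 0 < Y x &
    x * expR ((c - e) * Y x) <= S x <= x * expR ((c + e) * Y x)].
  by move=> e0; exact: near_sum_factorizations_bounds.
(* The equation is solved for [eps], so it holds as soon as S x, x and Y x are positive; the content
   is that [eps] tends to 0. *)
exists (fun x => ln (S x / x) / Y x - c); split.
  apply/cvgrPdist_le => e e0; near=> x.
  have [x0 Y0 /andP[lo up]] : [/\ 0 < x, 0 < Y x &
    x * expR ((c - e) * Y x) <= S x <= x * expR ((c + e) * Y x)].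
    by near: x; exact: bounds.
  have S0 : 0 < S x by apply: lt_le_trans lo; rewrite mulr_gt0 ?expR_gt0.
  have Sx0 : 0 < S x / x by exact: divr_gt0.
  have lnlo : (c - e) * Y x <= ln (S x / x).
    by rewrite -[leLHS]expRK ler_ln ?posrE ?expR_gt0// ler_pdivlMr// mulrC.
  have lnup : ln (S x / x) <= (c + e) * Y x.
    by rewrite -[leRHS]expRK ler_ln ?posrE ?expR_gt0// ler_pdivrMr// mulrC.
  rewrite -(ler_pdivlMr _ _ Y0) in lnlo; rewrite -(ler_pdivrMr _ _ Y0) in lnup.
  by rewrite sub0r normrN ler_norml; apply/andP; split; lra.
near=> x.
have [x0 Y0 /andP[lo _]] : [/\ 0 < x, 0 < Y x &
    x * expR ((c - 1) * Y x) <= S x <= x * expR ((c + 1) * Y x)].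
  by near: x; exact: bounds.
have S0 : 0 < S x by apply: lt_le_trans lo; rewrite mulr_gt0 ?expR_gt0.
rewrite -/(Y x) -/(S x) addrC subrK divfK ?gt_eqF// lnK ?posrE ?divr_gt0//.
by rewrite mulrC divfK// gt_eqF.
Unshelve. all: by end_near. Qed.
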